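(* Let $G$ be a (finite, simple) plane graph with minimum degree $5$ and maximum degree $\Delta\ge 16$. Then $G$ has a minor $5$-star with weight at most $\Delta+28$.
   Context: A plane graph is a graph embedded in the plane without edge crossings. A minor $5$-star in $G$ is a vertex of degree exactly $5$ (its center) together with its five neighbors. The weight of a subgraph $H$ of $G$ is $\sum_{v\in V(H)}\deg_G(v)$. *)

(* Defs.v *)
From HB Require Import structures.
From mathcomp Require Import all_boot all_order all_algebra.
From mathcomp Require Import all_classical all_reals all_analysis.
Import numFieldNormedType.Exports.

Set Implicit Arguments.
Unset Strict Implicit.
Unset Printing Implicit Defensive.

Local Open Scope classical_set_scope.
Local Open Scope ring_scope.

Record simple_graph := SimpleGraph {
  vertex :> finType;
  adj : rel vertex;
  adj_sym : symmetric adj;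
  adj_irrefl : irreflexive adj
}.
Arguments adj {s}.

Definition is_arc (R : realType) (A : set (R * R)) (p q : R * R) : Prop :=
  exists gamma : R -> R * R,
    [/\ {within `[0, 1], continuous gamma},
        {in `[0, 1] &, injective gamma},
        gamma 0 = p, gamma 1 = q & A = gamma @` `[0, 1]].

(* [edge_arc x y] is the closed arc, endpoints included, drawn for the edge
   [xy]; it is only constrained when [x] and [y] are adjacent. By
   [edge_arc_vertex] and [edge_arc_cross] together, two distinct edges can meet
   only at the position of a common endpoint. *)
Record plane_graph (R : realType) := PlaneGraph {
  graph :> simple_graph;
  pos : graph -> R * R;
  edge_arc : graph -> graph -> set (R * R);
  pos_inj : injective pos;
  edge_arcC : forall x y, adj x y -> edge_arc x y = edge_arc y x;
  edge_arcP : forall x y, adj x y -> is_arc (edge_arc x y) (pos x) (pos y);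
  edge_arc_vertex : forall x y z, adj x y ->
    edge_arc x y (pos z) -> z = x \/ z = y;
  edge_arc_cross : forall x y z t, adj x y -> adj z t ->
    [set x; y]%SET != [set z; t]%SET ->
    edge_arc x y `&` edge_arc z t `<=` range pos
}.

Local Open Scope nat_scope.
Local Open Scope set_scope.

Definition neighbors (G : simple_graph) (x : G) : {set G} :=
  [set y | adj x y]%SET.

Definition deg (G : simple_graph) (x : G) : nat := #|neighbors x|.

(* The neutral value #|G| exceeds every degree, so it is the result only when
   [G] has no vertices. *)
Definition min_degree (G : simple_graph) : nat :=
  \big[minn/#|G|]_(x : G) deg x.

Definition max_degree (G : simple_graph) : nat := \max_(x : G) deg x.

(* The weight of a subgraph depends only on its vertex set, so subgraphs are
   represented here by their vertex sets. *)
Definition weight (G : simple_graph) (H : {set G}) : nat :=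
  \sum_(x in H) deg x.

Definition minor_5_star (G : simple_graph) (H : {set G}) : Prop :=
  exists2 c : G, deg c = 5 & H = (c |: neighbors c)%SET.

(* Main.v *)
(** A plane graph is a minor of a large square grid: discretize small boxes
    around the vertices and the arcs outside these boxes. In the grid every
    cycle modulo 2 is a sum of unit squares; grouping the squares that are not
    separated by the minor yields subgraphs spanning the cycle space, with every
    edge on at most two of them (a 2-basis in the sense of MacLane). A basis
    among these and its sum play the role of the faces and satisfy Euler's
    inequality, which is all that is needed of planarity.

    Suppose that all 5-stars are heavy, and let D be the maximum degree. As in
    Lebesgue's theorem, every vertex of degree d > 6 distributes d - 6 over its
    angles and 5-vertices collect. All 5-vertices then receive at least 1, except
    when the neighbours have degrees D, 5, 9, 5, 5 in cyclic order with D = 16 or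
    D = 17, where at most 1/24 is missing. Such a vertex has a neighbour of degree
    5 with surplus at least 5/24, which can give 1/24 to each of its 5-neighbours.
    This contradicts Euler's inequality. *)

From HB Require Import structures.
From mathcomp Require Import all_boot all_order all_algebra.
From mathcomp Require Import ring lra zify.
Import Order.TTheory GRing.Theory Num.Theory.

Set Implicit Arguments.
Unset Strict Implicit.
Unset Printing Implicit Defensive.

(** * Connectivity in the square grid *)

(** The regions of the complement of the drawing never appear, so no Jordan curve theorem is needed;
    the only topology is that the arcs are compact and connected. The price is that a face is merely
    an even set of edges, possibly disconnected, that some edges lie on no face, and that no
    rotation of the edges around a vertex is given. The cyclic order of neighbours is therefore
    rebuilt only at 5-vertices where every edge lies on two faces and all faces are triangles:
    there, spanning a common triangle with the centre is a 2-regular relation on the five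
    neighbours, and five vertices are too few for two disjoint cycles. At any other 5-vertex the
    longer face or the edge on no face pays enough by itself. *)

Definition rel_in (T : finType) (e : rel T) (U : {set T}) : rel T :=
  fun x y => [&& e x y, x \in U & y \in U].

Definition set_connected (T : finType) (e : rel T) (U : {set T}) : Prop :=
  {in U &, forall x y, connect (rel_in e U) x y}.

Definition grid n : rel ('I_n * 'I_n) := fun p q =>
  ((p.1 - q.1) + (q.1 - p.1) + ((p.2 - q.2) + (q.2 - p.2)) == 1)%N.

Lemma rel_in_sym (T : finType) (e : rel T) U :
  symmetric e -> symmetric (rel_in e U).
Proof. by move=> se x y; rewrite /rel_in se [(x \in U) && _]andbC. Qed.

Lemma connect_rel_in_sub (T : finType) (e : rel T) (U W : {set T}) x y :
  U \subset W -> connect (rel_in e U) x y -> connect (rel_in e W) x y.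
Proof.
move=> sUW; apply: connect_sub => u v /and3P[euv uU vU]; apply: connect1.
by rewrite /rel_in euv !(fintype.subsetP sUW).
Qed.

Lemma set_connected_from (T : finType) (e : rel T) (U : {set T}) x0 :
  symmetric e -> {in U, forall x, connect (rel_in e U) x0 x} -> set_connected e U.
Proof.
move=> se H x y xU yU; apply: connect_trans (H y yU).
by rewrite (sym_connect_sym (rel_in_sym U se)) H.
Qed.

Lemma grid_sym n : symmetric (@grid n).
Proof. by move=> p q; rewrite /grid; lia. Qed.

Lemma connect_first_exit (T : finType) (e : rel T) (U C : {set T}) p q :
  p \in C -> q \notin C -> connect (rel_in e U) p q ->
  exists u v, [/\ u \in C, v \notin C, e u v & v \in U].
Proof.
move=> + + /connectP[s]; elim: s p => [|v s IH] p /= pC qC.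
  by move=> _ E; rewrite E pC in qC.
case/andP=> /and3P[epv pU vU] ps E.
by have [vC|vC] := boolP (v \in C); [exact: (IH v) | exists p, v].
Qed.

(** Induction on the L1 distance: a step towards [q] in a coordinate that still differs stays in the
    rectangle, because [I] and [J] are order-convex. *)
Lemma rect_connected n (I J : pred nat) (p q : 'I_n * 'I_n) :
  (forall i j k, i <= k <= j -> I i -> I j -> I k)%N ->
  (forall i j k, i <= k <= j -> J i -> J j -> J k)%N ->
  I p.1 -> J p.2 -> I q.1 -> J q.2 ->
  connect (rel_in (@grid n) [set p : 'I_n * 'I_n | I p.1 && J p.2]) p q.
Proof.
move=> cI cJ; set U := [set _ | _].
suff H k : forall p q : 'I_n * 'I_n, ((p.1 - q.1) + (q.1 - p.1) + ((p.2 - q.2) + (q.2 - p.2)) <= k)%N ->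
    p \in U -> q \in U -> connect (rel_in (@grid n) U) p q.
  by move=> *; apply: (H _ _ _ (leqnn _)); rewrite inE; apply/andP.
elim: k {p q} => [|k IH] [p1 p2] [q1 q2] /=.
  move=> le0 _ _; suff -> : (p1, p2) = (q1, q2) by exact: connect0.
  by congr pair; apply: ord_inj; lia.
move=> lek pU qU; move: (pU) (qU); rewrite !inE /= => /andP[Ip Jp] /andP[Iq Jq].
have step (r : 'I_n * 'I_n) : grid (p1, p2) r -> r \in U ->
    ((r.1 - q1) + (q1 - r.1) + ((r.2 - q2) + (q2 - r.2)) <= k)%N ->
    connect (rel_in (@grid n) U) (p1, p2) (q1, q2).
  move=> g rU d; have h : connect (rel_in (@grid n) U) (p1, p2) r.
    by apply: connect1; apply/and3P.
  by apply: (connect_trans h); exact: IH.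
have [lt1|lt1|e1] := ltngtP p1 q1.
- have lt : (p1.+1 < n)%N by have := ltn_ord q1; lia.
  apply: (step (Ordinal lt, p2)); rewrite /grid ?inE /=; try lia.
  by rewrite Jp andbT; apply: (cI p1 q1) => //; lia.
- have lt : (p1.-1 < n)%N by have := ltn_ord p1; lia.
  apply: (step (Ordinal lt, p2)); rewrite /grid ?inE /=; try lia.
  by rewrite Jp andbT; apply: (cI q1 p1) => //; lia.
have [lt2|lt2|e2] := ltngtP p2 q2.
- have lt : (p2.+1 < n)%N by have := ltn_ord q2; lia.
  apply: (step (p1, Ordinal lt)); rewrite /grid ?inE /=; try lia.
  by rewrite Ip; apply: (cJ p2 q2) => //; lia.
- have lt : (p2.-1 < n)%N by have := ltn_ord p2; lia.
  apply: (step (p1, Ordinal lt)); rewrite /grid ?inE /=; try lia.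
  by rewrite Ip; apply: (cJ q2 p2) => //; lia.
suff -> : (p1, p2) = (q1, q2) by exact: connect0.
by congr pair; apply: val_inj.
Qed.

Local Open Scope ring_scope.

(** * Chains modulo 2 in the grid *)

Lemma F2addrr (x : 'F_2) : x + x = 0.
Proof. by apply: val_inj; case: x => [[|[|]]]. Qed.

Lemma F2eq (x y : 'F_2) : x + y = 0 -> x = y.
Proof. by move=> h; rewrite -[x]addr0 -(F2addrr y) addrA h add0r. Qed.

Section GridCells.
Variable n : nat.
Local Notation point := ('I_n.+1 * 'I_n.+1)%type.
Local Notation cell := ('I_n.+2 * 'I_n.+2)%type.

(** These are the points with all four grid neighbours. Cells have one index more than points, since
    [cell_lo] can reach [n.+1]. *)
Definition inner_point (p : point) : bool := (0 < p.1 < n)%N && (0 < p.2 < n)%N.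

(* The two unit squares on either side of the grid edge [pq]; the square with
   upper right corner [(i, j)] is the cell [(i, j)]. *)
Definition cell_hi (p q : point) : cell :=
  (inord (maxn p.1 q.1), inord (maxn p.2 q.2)).
Definition cell_lo (p q : point) : cell :=
  (inord (minn p.1 q.1).+1, inord (minn p.2 q.2).+1).

Definition pt (i j : nat) : point := (inord i, inord j).

Lemma cell_hiC p q : cell_hi p q = cell_hi q p.
Proof. by rewrite /cell_hi maxnC [maxn p.2 _]maxnC. Qed.

Lemma cell_loC p q : cell_lo p q = cell_lo q p.
Proof. by rewrite /cell_lo minnC [minn p.2 _]minnC. Qed.

Lemma pt_eq (q : point) i j : (i <= n)%N -> (j <= n)%N ->
  (q == pt i j) = (val q.1 == i) && (val q.2 == j).
Proof.
case: q => q1 q2 hi hj; rewrite /pt xpair_eqE.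
by congr andb; rewrite -val_eqE /= inordK. Qed.

Lemma grid_sum (F : point -> 'F_2) i j : (0 < i < n)%N -> (0 < j < n)%N ->
  \sum_(q | grid (pt i j) q) F q =
  F (pt i.-1 j) + F (pt i.+1 j) + F (pt i j.-1) + F (pt i j.+1).
Proof.
move=> hi hj.
pose s := [:: pt i.-1 j; pt i.+1 j; pt i j.-1; pt i j.+1].
rewrite (eq_bigl (mem s)) => [|q].
  rewrite -big_uniq /=.
    by rewrite !big_cons big_nil addr0 !addrA.
  by rewrite !inE !pt_eq /= ?inordK //=; lia.
rewrite !inE !pt_eq; try lia.
rewrite /grid /pt /= !inordK; lia.
Qed.

(** Each of the four squares around [p] is bounded by two of the four edges at [p], so its
    coefficient cancels. *)
Lemma cell_boundary_closed (a : cell -> 'F_2) p : inner_point p ->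
  \sum_(q | grid p q) (a (cell_hi p q) + a (cell_lo p q)) = 0.
Proof.
case: p => [[i hi] [j hj]] /andP[/= i0 j0].
have -> : (Ordinal hi, Ordinal hj) = pt i j.
  by congr pair; apply: val_inj; rewrite /= inordK.
rewrite grid_sum // /cell_hi /cell_lo /= !inordK; try lia.
have [k ik] : exists k, i = k.+1 by exists i.-1; lia.
have [l jl] : exists l, j = l.+1 by exists j.-1; lia.
subst i j; rewrite /= !maxnn !minnn.
have e (m : nat) : (maxn m.+1 m = m.+1) * (maxn m.+1 m.+2 = m.+2) *
   (minn m.+1 m = m) * (minn m.+1 m.+2 = m.+1) by do !split; lia.
rewrite !e.
set x := a _; set y := a _; set z := a (_, _); set t := a (_, _).
have -> : x + y + (z + t) + (x + z) + (y + t) = (x + x) + (y + y) + (z + z) + (t + t).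
  by ring.
by rewrite !F2addrr.
Qed.

(** The source of planarity: the first homology modulo 2 of the square vanishes. The coefficient of
    a square is the parity with which [z] crosses the vertical ray going down from it. *)
Lemma closed_is_cell_boundary (z : point -> point -> 'F_2) :
  (forall p q, z p q = z q p) ->
  (forall p q, z p q != 0 -> inner_point p) ->
  (forall p, inner_point p -> \sum_(q | grid p q) z p q = 0) ->
  exists a : cell -> 'F_2, forall p q, grid p q ->
    z p q = a (cell_hi p q) + a (cell_lo p q).
Proof.
move=> zC zint zclosed.
have z0 p q : ~~ inner_point p -> z p q = 0.
  by apply: contraNeq => /zint.
(* The value of [z] on the horizontal edge at height [k] in column [i] of squares; the outer columns
   0 and [n.+1] contain no such edge. *)
pose col i k := if (0 < i <= n)%N then z (pt i.-1 k) (pt i k) else 0.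
have colL i k : ~~ inner_point (pt i k) -> col i k = 0.
  by move=> h; rewrite /col; case: ifP => // _; rewrite zC z0.
have colR i k : ~~ inner_point (pt i k) -> col i.+1 k = 0.
  by move=> h; rewrite /col; case: ifP => // _; rewrite z0.
have intE i j : (i <= n)%N -> (j <= n)%N ->
    inner_point (pt i j) = (0 < i < n)%N && (0 < j < n)%N.
  by move=> hi hj; rewrite /inner_point /= !inordK.
(* Adding up the closedness conditions along a vertical line telescopes: the downward rays in two
   neighbouring columns differ by the value on the vertical edge where they start. *)
have vert i j : (i <= n)%N -> (j < n)%N ->
    \sum_(0 <= k < j.+1) (col i k + col i.+1 k) = z (pt i j) (pt i j.+1).
  move=> hi; elim: j => [|j IH] hj.
    have nI : ~~ inner_point (pt i 0) by rewrite intE // andbF.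
    by rewrite big_nat1 colL // colR // z0 // addr0.
  rewrite big_nat_recr //= IH; last by lia.
  have [I|nI] := boolP (inner_point (pt i j.+1)); last first.
    by rewrite colL // colR // zC !(z0 (pt i j.+1)) // !addr0.
  have := I; rewrite intE //; last by lia.
  case/andP=> i0 j0; have := zclosed _ I; rewrite grid_sum //= => h.
  rewrite /col; have -> : (0 < i <= n)%N by lia.
  have -> : (0 < i.+1 <= n)%N by lia.
  rewrite [z (pt i.-1 _) _]zC [z (pt i j) _]zC /=.
  set u := z _ (pt i j) in h *; set v := z _ (pt i.-1 _) in h *.
  set w := z _ (pt i.+1 _) in h *; set t := z _ _ in h *.
  by apply: F2eq; rewrite -h; ring.
pose a (s : cell) := \sum_(0 <= k < s.2) col s.1 k.
exists a => p q.
suff H : forall p q : point, grid p q -> (p.1 <= q.1)%N && (p.2 <= q.2)%N ->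
    z p q = a (cell_hi p q) + a (cell_lo p q).
  move=> g; have [le|nle] := boolP ((p.1 <= q.1)%N && (p.2 <= q.2)%N); first exact: H.
  rewrite zC cell_hiC cell_loC H //; first by rewrite grid_sym.
  by move: g nle; rewrite /grid; lia.
move=> {}p {}q g le.
have ptE (r : point) : r = pt r.1 r.2 by rewrite /pt !inord_val; case: r.
have := g; rewrite /grid => g'.
have [p1 p2] : (p.1 <= n)%N /\ (p.2 <= n)%N by split; rewrite -ltnS.
have [q1 q2] : (q.1 <= n)%N /\ (q.2 <= n)%N by split; rewrite -ltnS.
have [E|E] : (q.1 = p.1.+1 :> nat /\ q.2 = p.2 :> nat) \/
  (q.1 = p.1 :> nat /\ q.2 = p.2.+1 :> nat) by lia.
- rewrite /a /cell_hi /cell_lo /=.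
  have -> : maxn p.1 q.1 = p.1.+1 by lia.
  have -> : minn p.1 q.1 = p.1 by lia.
  have -> : maxn p.2 q.2 = p.2 by lia.
  have -> : minn p.2 q.2 = p.2 by lia.
  rewrite !inordK; try lia.
  rewrite big_nat_recr //= addrA F2addrr add0r /col.
  have -> : (0 < p.1.+1 <= n)%N by lia.
  by rewrite (ptE p) (ptE q) /=; congr (z (pt _ _) (pt _ _)); rewrite /= ?inordK; lia.
- rewrite /a /cell_hi /cell_lo /=.
  have -> : maxn p.1 q.1 = p.1 by lia.
  have -> : minn p.1 q.1 = p.1 by lia.
  have -> : maxn p.2 q.2 = p.2.+1 by lia.
  have -> : minn p.2 q.2 = p.2 by lia.
  rewrite !inordK; try lia.
  rewrite -big_split /= vert //; try lia.
  by rewrite {1}(ptE p) {1}(ptE q); congr (z (pt _ _) (pt _ _)); lia.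
Qed.

End GridCells.

(** * Chains with prescribed boundary in a connected set *)

Section Fill.
Variables (T : finType) (e : rel T).
Hypotheses (esym : symmetric e) (eirr : irreflexive e).

Lemma path_chain (U : {set T}) x y : connect (rel_in e U) x y ->
  exists z : T -> T -> 'F_2,
    [/\ forall p q, z p q = z q p,
        forall p q, z p q != 0 -> rel_in e U p q &
        forall p, \sum_q z p q = (p == x)%:R + (p == y)%:R].
Proof.
case/connectP=> s; elim: s x => [|v s IH] x /=.
  move=> _ ->; exists (fun _ _ => 0); split=> [//|p q|p]; first by rewrite eqxx.
  by rewrite big1 // F2addrr.
case/andP=> xv vs yE; have [z [zC zU zb]] := IH v vs yE.
have xNv : x != v by apply/eqP => E; case/and3P: xv; rewrite E eirr.
pose d (p q : T) : 'F_2 := ((p == x) && (q == v))%:R + ((p == v) && (q == x))%:R.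
exists (fun p q => d p q + z p q); split.
- move=> p q; rewrite zC /d; congr (_ + _).
  by rewrite ![(q == _) && _]andbC addrC.
- move=> p q; have [zpq|/zU //] := eqVneq (z p q) 0; rewrite zpq addr0 /d.
  case: andP => [[/eqP -> /eqP ->] //|_]; case: andP => [[/eqP -> /eqP ->] _|_].
    by rewrite (rel_in_sym U esym).
  by rewrite addr0 eqxx.
- move=> p; rewrite big_split /= zb /d big_split /=.
  have S (a b : T) : \sum_q ((p == a) && (q == b))%:R = (p == a)%:R :> 'F_2.
    rewrite (bigD1 b) //= eqxx andbT big1 ?addr0 // => q /negPf ->.
    by rewrite andbF.
  by rewrite !S -!addrA; congr (_ + _); rewrite addrA F2addrr add0r.
Qed.

(** Send the mass [b x] of every point along a path to one root [r]; what accumulates at [r] is the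
    total mass, which is zero. *)
Lemma connected_fill (U : {set T}) (b : T -> 'F_2) : set_connected e U ->
  \sum_(p in U) b p = 0 ->
  exists z : T -> T -> 'F_2,
    [/\ forall p q, z p q = z q p,
        forall p q, z p q != 0 -> rel_in e U p q &
        forall p, p \in U -> \sum_q z p q = b p].
Proof.
move=> cU sb; have [->|[r rU]] := set_0Vmem U.
  by exists (fun _ _ => 0); split=> // p; rewrite ?eqxx ?inE.
have /fin_all_exists[z Hz] : forall x : T, exists z : T -> T -> 'F_2,
    [/\ forall p q, z p q = z q p,
        forall p q, z p q != 0 -> rel_in e U p q &
        x \in U -> forall p, \sum_q z p q = (p == x)%:R + (p == r)%:R].
  move=> x; have [xU|xU] := boolP (x \in U).
    by have [z [? ? zb]] := path_chain (cU x r xU rU); exists z.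
  by exists (fun _ _ => 0); split=> // p q; rewrite eqxx.
exists (fun p q => \sum_(x in U) b x * z x p q); split.
- by move=> p q; apply: eq_bigr => x _; have [-> _ _] := Hz x.
- move=> p q; apply: contraNT => h; rewrite big1 // => x _.
  by have [_ zU _] := Hz x; rewrite (contraNeq (zU p q)) ?mulr0.
- move=> p pU; rewrite exchange_big /=.
  under eq_bigr => x xU.
    rewrite -mulr_sumr; have [_ _ zb] := Hz x; rewrite zb // mulrDr; over.
  rewrite big_split /= -mulr_suml sb mul0r addr0 (bigD1 p) //= eqxx mulr1.
  by rewrite big1 ?addr0 // => q /andP[_ /negPf]; rewrite eq_sym => ->; rewrite mulr0.
Qed.

End Fill.

(** * Faces of a grid minor *)

Lemma F2_sym_sum0 (T : Type) (s : seq T) (z : T -> T -> 'F_2) :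
  (forall p q, z p q = z q p) -> (forall p, z p p = 0) ->
  \sum_(p <- s) \sum_(q <- s) z p q = 0.
Proof.
move=> zC z0; elim: s => [|x s IH]; first by rewrite big_nil.
rewrite !big_cons z0 add0r.
rewrite [X in _ + X](eq_bigr (fun p => z x p + \sum_(q <- s) z p q)).
  by rewrite big_split /= IH addr0 F2addrr.
by move=> p _; rewrite big_cons zC.
Qed.

Lemma connect_eq (T : finType) (U : Type) (r : rel T) (f : T -> U) x y :
  (forall x y, r x y -> f x = f y) -> connect r x y -> f x = f y.
Proof.
move=> H /connectP[s]; elim: s x => [|v s IH] x /=; first by move=> _ ->.
by case/andP=> /H -> /IH h /h.
Qed.

Lemma sum_pick (T : finType) (f : T -> 'F_2) (a : T) :
  \sum_k f k * (a == k)%:R = f a.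
Proof.
rewrite (bigD1 a) //= eqxx mulr1 big1 ?addr0 // => k /negPf.
by rewrite eq_sym => ->; rewrite mulr0.
Qed.

Section GridMinor.
Variables (n : nat) (V E : finType) (src tgt : E -> V).
Local Notation point := ('I_n.+1 * 'I_n.+1)%type.
Local Notation cell := ('I_n.+2 * 'I_n.+2)%type.
Variables (B : V -> {set point}) (lp lq : E -> point).
Hypotheses (Bint : forall x p, p \in B x -> inner_point p)
  (Bdisj : forall x y p, p \in B x -> p \in B y -> x = y)
  (Bconn : forall x, set_connected (@grid n.+1) (B x))
  (loopless : forall e, src e != tgt e)
  (simple : forall e e', (src e == src e') && (tgt e == tgt e')
     || (src e == tgt e') && (tgt e == src e') -> e = e')
  (lpB : forall e, lp e \in B (src e)) (lqB : forall e, lq e \in B (tgt e))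
  (lpq : forall e, grid (lp e) (lq e)).

Let is_link e (p q : point) : bool :=
  ((p == lp e) && (q == lq e)) || ((p == lq e) && (q == lp e)).

Let linkN e : lp e != lq e.
Proof.
apply/eqP => h; have := loopless e.
by rewrite (@Bdisj (src e) (tgt e) (lp e)) ?eqxx // h lqB.
Qed.

Let is_linkE e p q : (is_link e p q)%:R =
  ((p == lp e) && (q == lq e))%:R + ((p == lq e) && (q == lp e))%:R :> 'F_2.
Proof.
rewrite /is_link; case: andP => [[/eqP -> _]|_]; last by rewrite add0r.
by rewrite (negPf (linkN e)) addr0.
Qed.

Let is_linkC e p q : is_link e p q = is_link e q p.
Proof. by rewrite /is_link orbC [(q == lp e) && _]andbC [(q == lq e) && _]andbC. Qed.

Let link_inj e e' p q : is_link e p q -> is_link e' p q -> e = e'.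
Proof.
have D (x y : V) p' : p' \in B x -> p' \in B y -> x == y by move=> h /(Bdisj h) ->.
move=> h h'; apply: simple; move: h h'; rewrite /is_link.
case/orP=> /andP[/eqP -> /eqP ->] /orP[] /andP[/eqP h1 /eqP h2]; apply/orP.
- by left; rewrite (D _ _ (lp e)) ?(D _ _ (lq e)) // ?h1 ?h2.
- by right; rewrite (D _ _ (lp e)) ?(D _ _ (lq e)) // ?h1 ?h2.
- by right; rewrite (D _ _ (lp e)) ?(D _ _ (lq e)) // ?h1 ?h2.
- by left; rewrite (D _ _ (lp e)) ?(D _ _ (lq e)) // ?h1 ?h2.
Qed.

(** Grid edges that separate faces. Among the grid edges between two branch sets only the chosen
    link counts, so each edge of the graph is seen once. *)
Let wall (p q : point) : bool :=
  [exists x, (p \in B x) && (q \in B x)] || [exists e, is_link e p q].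

Let same_face (s t : cell) : bool :=
  [exists p : point, exists q : point, [&& grid p q, ~~ wall p q &
    ((s == cell_hi p q) && (t == cell_lo p q)) ||
    ((t == cell_hi p q) && (s == cell_lo p q))]].

Let face (s : cell) : cell := fingraph.root same_face s.

Let face_eq p q : grid p q -> ~~ wall p q -> face (cell_hi p q) = face (cell_lo p q).
Proof.
move=> g w; apply/fingraph.rootP.
  apply: sym_connect_sym => s t; apply: eq_existsb => u; apply: eq_existsb => v.
  by rewrite orbC.
apply: connect1; apply/existsP; exists p; apply/existsP; exists q.
by rewrite g w !eqxx.
Qed.

(** The coefficient of the grid edge [pq] in the boundary of the face [k] modulo 2; it is 0 if [k]
    lies on both sides. *)
Definition face_side (k : cell) (p q : point) : 'F_2 :=
  (face (cell_hi p q) == k)%:R + (face (cell_lo p q) == k)%:R.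

Let face_sideC k p q : face_side k p q = face_side k q p.
Proof. by rewrite /face_side cell_hiC cell_loC. Qed.

Let link_side k e p q : is_link e p q -> face_side k p q = face_side k (lp e) (lq e).
Proof. by case/orP=> /andP[/eqP -> /eqP ->] //; exact: face_sideC. Qed.

Let sum_link e v (x : 'F_2) :
  \sum_(p in B v) \sum_(q | q \notin B v) (is_link e p q)%:R * x =
  x * ((src e == v)%:R + (tgt e == v)%:R).
Proof.
have S a b (A1 A2 : {pred point}) : \sum_(p in A1) \sum_(q in A2)
    ((p == a) && (q == b))%:R * x = x * ((a \in A1) && (b \in A2))%:R.
  have [aA|aA] := boolP (a \in A1); last first.
    rewrite big1 ?mulr0 // => p pA; rewrite big1 // => q _.
    case: eqP => [Ea|_]; last by rewrite mul0r.
    by rewrite -Ea pA in aA.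
  rewrite (bigD1 a) //= [X in _ + X]big1 ?addr0 => [|p /andP[_ /negPf ->]]; last first.
    by rewrite big1 // => q _; rewrite mul0r.
  have [bA|bA] := boolP (b \in A2); last first.
    rewrite big1 ?mulr0 // => q qA; rewrite eqxx.
    case: eqP => [Ea|_]; last by rewrite mul0r.
    by rewrite -Ea qA in bA.
  rewrite (bigD1 b) //= !eqxx mul1r mulr1 big1 ?addr0 // => q /andP[_ /negPf ->].
  by rewrite mul0r.
under eq_bigr => p _ do under eq_bigr => q _ do rewrite is_linkE mulrDl.
under eq_bigr => p _ do rewrite big_split /=.
rewrite big_split /= (S _ _ (mem (B v)) [pred q | q \notin B v]).
rewrite (S _ _ (mem (B v)) [pred q | q \notin B v]) !inE /= -mulrDr.
have inB z w p : p \in B z -> (p \in B w) = (z == w).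
  move=> h; apply/idP/eqP => [|<- //]; exact: Bdisj h.
rewrite (inB _ v _ (lpB e)) (inB _ v _ (lqB e)); congr (_ * (_%:R + _%:R)).
  by have := loopless e; have [->|//] := eqVneq (src e) v; rewrite eq_sym => ->.
by have := loopless e; have [->|//] := eqVneq (tgt e) v; move=> ->.
Qed.

(** Contraction of [B v]: the boundary of a face has even degree at every point of [B v]. Summed
    over these points, edges inside [B v] count twice, and among the edges leaving [B v] only links
    are walls. *)
Lemma face_side_closed k v :
  \sum_e face_side k (lp e) (lq e) * ((src e == v)%:R + (tgt e == v)%:R) = 0.
Proof.
pose z p q : 'F_2 := if grid p q then face_side k p q else 0.
have zC p q : z p q = z q p by rewrite /z grid_sym face_sideC.
have zw p q : ~~ wall p q -> z p q = 0.
  by rewrite /z; case: ifP => // g w; rewrite /face_side (face_eq g w) F2addrr.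
have zb : \sum_(p in B v) \sum_q z p q = 0.
  rewrite big1 // => p pv; rewrite -big_mkcond /=.
  exact: (cell_boundary_closed (fun s => (face s == k)%:R) (Bint pv)).
have : \sum_(p in B v) \sum_(q in B v) z p q +
       \sum_(p in B v) \sum_(q | q \notin B v) z p q = 0.
  by rewrite -big_split -[RHS]zb; apply: eq_bigr => p _; rewrite [RHS](bigID (mem (B v))).
have -> : \sum_(p in B v) \sum_(q in B v) z p q = 0.
  rewrite -!big_enum; under eq_bigr do rewrite -big_enum.
  apply: F2_sym_sum0 => // p; rewrite /z.
  by have -> : grid p p = false by rewrite /grid; lia.
rewrite add0r => h; rewrite -[RHS]h.
rewrite (eq_bigr (fun e => \sum_(p in B v) \sum_(q | q \notin B v)
   (is_link e p q)%:R * face_side k (lp e) (lq e))); last by move=> e _; rewrite sum_link.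
rewrite exchange_big /=; apply: eq_bigr => p pv.
rewrite exchange_big /=; apply: eq_bigr => q qv.
have [/existsP[e pqe]|/existsPn N] := boolP [exists e, is_link e p q].
  rewrite (bigD1 e) //= pqe mul1r big1 ?addr0 => [|e' ne].
    rewrite /z (link_side k pqe) /is_link; case: ifP => // /negP[].
    by case/orP: pqe => /andP[/eqP -> /eqP ->]; rewrite // grid_sym.
  suff -> : is_link e' p q = false by rewrite mul0r.
  by apply: contraNF ne => h'; rewrite (link_inj pqe h').
rewrite zw ?big1 // => [e _|]; first by rewrite (negPf (N e)) mul0r.
apply/norP; split; last exact/existsPn.
apply/existsPn => x; apply/andP => -[px qx].
by rewrite (Bdisj px pv) in qx; rewrite qx in qv.
Qed.

(** The cycle [w] is lifted to a closed chain [z] of the grid by filling in each branch set; [z] is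
    a sum of squares, and these squares group into whole faces. *)
Lemma cycle_is_face_sum (w : E -> 'F_2) :
  (forall v, \sum_e w e * ((src e == v)%:R + (tgt e == v)%:R) = 0) ->
  exists c : cell -> 'F_2, forall e, w e = \sum_k c k * face_side k (lp e) (lq e).
Proof.
move=> wcyc.
have gsym := @grid_sym n.+1.
have girr : irreflexive (@grid n.+1) by move=> p; rewrite /grid; lia.
(* The boundary of the links weighted by [w]. The cycle condition at [v] says exactly that [b] sums
   to zero over [B v], as the filling requires. *)
pose b p : 'F_2 := \sum_e w e * ((p == lp e)%:R + (p == lq e)%:R).
have /fin_all_exists[zv Hzv] : forall v, exists z : point -> point -> 'F_2,
    [/\ forall p q, z p q = z q p,
        forall p q, z p q != 0 -> rel_in (@grid n.+1) (B v) p q &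
        forall p, p \in B v -> \sum_q z p q = b p].
  move=> v.
  have S a : \sum_(p in B v) (p == a)%:R = (a \in B v)%:R :> 'F_2.
    have [aB|aB] := boolP (a \in B v).
      by rewrite (bigD1 a) //= eqxx big1 ?addr0 // => p /andP[_ /negPf ->].
    by rewrite big1 // => p pB; case: eqP => // pa; rewrite -pa pB in aB.
  have inB x p : p \in B x -> (p \in B v) = (x == v).
    by move=> h; apply/idP/eqP => [|<- //]; exact: Bdisj h.
  apply: (connected_fill gsym girr (b := b) (@Bconn v)).
  rewrite exchange_big /= -[RHS](wcyc v); apply: eq_bigr => e _.
  by rewrite -mulr_sumr big_split /= !S (inB _ _ (lpB e)) (inB _ _ (lqB e)).
pose z p q := \sum_v zv v p q + \sum_e w e * (is_link e p q)%:R.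
have zvN v p q : p \notin B v -> zv v p q = 0.
  by move=> pv; have [_ zU _] := Hzv v; apply: contraNeq pv => /zU /and3P[].
have linkB e p q : is_link e p q -> exists v, p \in B v.
  by case/orP=> /andP[/eqP -> _]; [exists (src e) | exists (tgt e)].
have linkg e p q : is_link e p q -> grid p q.
  by case/orP=> /andP[/eqP -> /eqP ->] //; rewrite gsym.
have zC p q : z p q = z q p.
  congr (_ + _); first by apply: eq_bigr => v _; have [-> _ _] := Hzv v.
  by apply: eq_bigr => e _; rewrite is_linkC.
have zg p q : ~~ grid p q -> z p q = 0.
  move=> ng; rewrite /z !big1 ?addr0 // => [e _|v _].
    have -> : is_link e p q = false by apply: contraNF ng; exact: linkg.
    by rewrite mulr0.
  by have [_ zU _] := Hzv v; apply: contraNeq ng => /zU /and3P[].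
have zsum p : \sum_q z p q = 0.
  rewrite /z big_split /= exchange_big /= [X in _ + X]exchange_big /=.
  have -> : \sum_e \sum_q w e * (is_link e p q)%:R = b p.
    apply: eq_bigr => e _; rewrite -mulr_sumr; congr (_ * _).
    have S (x y : point) : \sum_q ((p == x) && (q == y))%:R = (p == x)%:R :> 'F_2.
      rewrite (bigD1 y) //= eqxx andbT big1 ?addr0 // => q /negPf ->.
      by rewrite andbF.
    under eq_bigr => q _ do rewrite is_linkE.
    by rewrite big_split /= !S.
  have [/existsP[v pv]|/existsPn N] := boolP [exists v, p \in B v].
    rewrite (bigD1 v) //= [X in _ + X + _]big1 ?addr0 => [|v' ne].
      by have [_ _ ->] := Hzv v; rewrite ?F2addrr.
    rewrite big1 // => q _; apply: zvN; apply: contra ne => pv'.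
    by rewrite (Bdisj pv' pv).
  rewrite big1 ?add0r => [|v _]; last by rewrite big1 // => q _; exact: zvN.
  rewrite /b big1 // => e _.
  have -> : (p == lp e) = false.
    by apply: contraNF (N (src e)) => /eqP ->.
  have -> : (p == lq e) = false.
    by apply: contraNF (N (tgt e)) => /eqP ->.
  by rewrite addr0 mulr0.
have [|p _|a Ha] := closed_is_cell_boundary zC.
- move=> p q; apply: contraNT => nI.
  have pN v : p \notin B v by apply: contra nI; exact: Bint.
  rewrite /z !big1 ?addr0 // => [e _|v _]; last exact: zvN.
  have -> : is_link e p q = false by apply/negP => /linkB[v]; rewrite (negPf (pN v)).
  by rewrite mulr0.
- rewrite big_mkcond /= -[RHS](zsum p); apply: eq_bigr => q _.
  by case: ifP => // /negbT/zg.
(* [z] vanishes off the walls, so squares sharing such an edge have the same coefficient. *)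
have aface s : a s = a (face s).
  apply: (@connect_eq _ _ same_face); last exact: fingraph.connect_root.
  have main p q : grid p q -> ~~ wall p q -> a (cell_hi p q) = a (cell_lo p q).
    move=> g /norP[/existsPn nB /existsPn nl]; apply: F2eq; rewrite -Ha //.
    rewrite /z !big1 ?addr0 // => [e _|v _]; first by rewrite (negPf (nl e)) mulr0.
    by have [_ zU _] := Hzv v; apply: contraNeq (nB v) => /zU /and3P[_ -> ->].
  move=> u v /existsP[p /existsP[q /and3P[g w']]].
  by case/orP=> /andP[/eqP -> /eqP ->]; rewrite (main p q).
exists a => e.
under eq_bigr => k _ do rewrite /face_side mulrDr.
rewrite big_split /= !sum_pick -!aface -Ha // /z big1 ?add0r => [|v _].
  have lee : is_link e (lp e) (lq e) by rewrite /is_link !eqxx.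
  rewrite (bigD1 e) //= lee mulr1 big1 ?addr0 // => e' ne.
  have -> : is_link e' (lp e) (lq e) = false.
    by apply: contraNF ne => h; rewrite (link_inj h lee).
  by rewrite mulr0.
have [_ zU _] := Hzv v; apply/eqP; apply: contraNT (loopless e) => /zU /and3P[_ h1 h2].
by rewrite (Bdisj (lpB e) h1) (Bdisj (lqB e) h2).
Qed.

Lemma face_side_two e : exists k1 k2, forall k,
  face_side k (lp e) (lq e) = (k1 == k)%:R + (k2 == k)%:R.
Proof. by exists (face (cell_hi (lp e) (lq e))), (face (cell_lo (lp e) (lq e))). Qed.

End GridMinor.

(** * Face systems *)

(* MacLane's 2-bases: faces are even subgraphs, each edge lying on two of them or
   on none (bridges). [face_euler] reads [2 |E| + 4 <= 2 (|V| + k)]. *)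
Record face_system (V : finType) (adj : rel V) k (f : 'I_k -> rel V) : Prop :=
  FaceSystem {
    face_sym : forall i, symmetric (f i);
    face_sub : forall i x y, f i x y -> adj x y;
    face_even : forall i x, ~~ odd #|[set y | f i x y]|;
    face_nonempty : forall i, exists x y, f i x y;
    face_two : forall x y,
      #|[set i | f i x y]| = 0%N \/ #|[set i | f i x y]| = 2%N;
    face_inj : forall i j, f i =2 f j -> i = j;
    face_euler : (\sum_x #|[set y | adj x y]| + 4 <= (#|V| + k).*2)%N }.

Lemma F2_natr m : m%:R = (odd m)%:R :> 'F_2.
Proof.
rewrite -{1}[m]odd_double_half natrD -addnn natrD -mulr2n.
by rewrite mulr2n F2addrr addr0.
Qed.

Lemma F2_natr_eq0 m : m%:R = 0 :> 'F_2 -> ~~ odd m.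
Proof. by rewrite F2_natr; case: odd. Qed.

Lemma F2_neq0 (x : 'F_2) : x = (x != 0)%:R.
Proof. by apply: val_inj; case: x => [[|[|]]]. Qed.

Lemma sum_enum (T : finType) (G : T -> 'F_2) :
  \sum_(i < #|{: T}|) G (enum_val i) = \sum_t G t.
Proof. by rewrite [RHS](reindex _ (onW_bij _ (@enum_val_bij T))). Qed.

(** * From a spanning family of cycles to a face system *)

Section Edges.
Variables (V : finType) (adj : rel V).
Hypotheses (adjC : symmetric adj) (adjI : irreflexive adj).

Definition oriented (e : V * V) := adj e.1 e.2 && (enum_rank e.1 < enum_rank e.2)%N.
Definition edge := {e : V * V | oriented e}.

Definition joins (e : edge) x y := (val e == (x, y)) || (val e == (y, x)).

Lemma joins_adj e x y : joins e x y -> adj x y.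
Proof.
by case: e => [[u v] /= /andP[a _]] /orP[] /= /eqP[<- <-] //; rewrite adjC.
Qed.

Lemma joins_inj e e' x y : joins e x y -> joins e' x y -> e = e'.
Proof.
case: e e' => [[u v] o] [[u' v'] o']; have /andP[/= _ h] := o; have /andP[/= _ h'] := o'.
rewrite /joins /= => /orP[] /eqP[E1 E2] /orP[] /eqP[E1' E2']; apply: val_inj => /=;
  by move: h h'; rewrite E1 E2 E1' E2' //; lia.
Qed.

Lemma joinsC e x y : joins e x y = joins e y x.
Proof. by rewrite /joins orbC. Qed.

Lemma sum_deg_edge : (\sum_x #|[set y | adj x y]| = #|{: edge}|.*2)%N.
Proof.
have card_edge : #|{: edge}| = #|[set e | oriented e]|.
  by rewrite card_sig cardsE.
transitivity #|[set e : V * V | adj e.1 e.2]|.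
  rewrite -sum1dep_card -(pair_big_dep xpredT adj (fun _ _ => 1%N)) /=.
  by apply: eq_bigr => x _; rewrite sum1dep_card.
rewrite -(cardsID [set e | oriented e]) -addnn card_edge; congr addn.
  by apply: eq_card => e; rewrite !inE /oriented; case: adj.
pose sw (e : V * V) := (e.2, e.1).
have swK : injective sw by move=> [? ?] [? ?] [-> ->].
rewrite -(card_preimset [set e | oriented e] swK); apply: eq_card => -[x y].
rewrite !inE /oriented /= adjC; have [yx|] := boolP (adj y x); rewrite ?andbF //= andbT.
rewrite -leqNgt ltn_neqAle; case: eqP => // /ord_inj/enum_rank_inj E.
by move: yx; rewrite E adjI.
Qed.

Section FaceSystem.
Variables (K : finType) (F : K -> edge -> 'F_2).
Local Notation src e := ((val e).1).
Local Notation tgt e := ((val e).2).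
Hypotheses
  (Fclosed : forall k v, \sum_e F k e * ((src e == v)%:R + (tgt e == v)%:R) = 0)
  (Ftwo : forall e, exists k1 k2, forall k, F k e = (k1 == k)%:R + (k2 == k)%:R)
  (Fspan : forall w : edge -> 'F_2,
    (forall v, \sum_e w e * ((src e == v)%:R + (tgt e == v)%:R) = 0) ->
    exists c : K -> 'F_2, forall e, w e = \sum_k c k * F k e)
  (V0 : (0 < #|V|)%N) (VE : (#|V| < #|{: edge}|)%N).

Let M : 'M['F_2]_(#|K|, #|{: edge}|) := \matrix_(i, j) F (enum_val i) (enum_val j).

Let Inc : 'M['F_2]_(#|{: edge}|, #|V|) :=
  \matrix_(j, v) ((src (enum_val j) == enum_val v)%:R + (tgt (enum_val j) == enum_val v)%:R).

Let rank_Inc : (\rank Inc < #|V|)%N.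
Proof.
have h : Inc *m (const_mx 1 : 'cV_#|V|) = 0.
  apply/matrixP => j z; rewrite !mxE.
  under eq_bigr => v _ do rewrite !mxE mulr1.
  rewrite (sum_enum (fun v => (src (enum_val j) == v)%:R + (tgt (enum_val j) == v)%:R)).
  have S (a : V) : \sum_v (a == v)%:R = 1 :> 'F_2.
    by rewrite (bigD1 a) //= eqxx big1 ?addr0 // => v; rewrite eq_sym => /negPf ->.
  by rewrite big_split /= !S F2addrr.
have := mulmx0_rank_max h.
suff : (0 < \rank (const_mx 1%R : 'cV['F_2]_#|V|))%N by lia.
rewrite lt0n mxrank_eq0; apply/eqP => /matrixP /(_ (Ordinal V0) 0).
by rewrite !mxE.
Qed.

(** Euler's inequality as rank-nullity: the kernel of the incidence matrix is the cycle space, of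
    dimension at least |E| - |V| + 1, and the rows of [M] span it. *)
Let rank_M : (#|{: edge}| < \rank M + #|V|)%N.
Proof.
have : (kermx Inc <= M)%MS.
  apply/row_subP => i; set w := row i _.
  have wI : w *m Inc = 0 by rewrite -row_mul mulmx_ker row0.
  have [|c Hc] := Fspan (w := fun e => w 0 (enum_rank e)).
    move=> v; have := congr1 (fun A : 'rV_#|V| => A 0 (enum_rank v)) wI.
    rewrite !mxE => E; rewrite -[RHS]E -[LHS]sum_enum.
    by apply: eq_bigr => j _; rewrite enum_valK [Inc _ _]mxE enum_rankK.
  apply/submxP; exists (\row_k c (enum_val k)); apply/rowP => j.
  rewrite -[j in LHS]enum_valK Hc !mxE.
  rewrite -[LHS]sum_enum.
  by apply: eq_bigr => k _; rewrite !mxE.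
move/mxrankS; rewrite mxrank_ker; move: rank_Inc; move: (rank_leq_row Inc); lia.
Qed.

Let r := \rank M.
Let N : 'M['F_2]_(r, #|{: edge}|) := rowsub (maxrankfun M) M.

(* The outer face [ord0] is the sum of the chosen basis of faces, so that every
   edge lies on an even number of faces. *)
Let coef (i : 'I_r.+1) : 'rV['F_2]_r :=
  if unlift ord0 i is Some j then delta_mx 0 j else const_mx 1.

Let fr (i : 'I_r.+1) (e : edge) : 'F_2 := (coef i *m N) 0 (enum_rank e).

(** With a single basis face the outer face, being the sum, would coincide with it. *)
Let r2 : (1 < r)%N.
Proof. by move: rank_M VE V0; rewrite -/r; lia. Qed.

Let N_inj (c d : 'rV_r) : c *m N = d *m N -> c = d.
Proof. exact: (row_free_inj (maxrowsub_free M)). Qed.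

Let coef_inj : injective coef.
Proof.
have ne j : delta_mx 0 j <> const_mx 1 :> 'rV['F_2]_r.
  move/rowP => h; pose j' : 'I_r := if j == Ordinal (ltnW r2) then Ordinal r2 else Ordinal (ltnW r2).
  have := h j'; rewrite !mxE eqxx /= /j'; case: (eqVneq j (Ordinal (ltnW r2))) => [->|ne] //.
  by rewrite eq_sym (negPf ne).
move=> i j; rewrite /coef; case: unliftP => [i' ->|->]; case: unliftP => [j' ->|->] //.
- move/rowP => /(_ j'); rewrite !mxE !eqxx /=; case: eqP => [-> //|_].
  by move/eqP; rewrite eq_sym oner_eq0.
- by move/ne.
- by move/esym/ne.
Qed.

Let coef_neq0 i : coef i != 0.
Proof.
rewrite /coef; case: unliftP => [j _|_]; apply/eqP => /rowP.
  by move/(_ j); rewrite !mxE !eqxx.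
by move/(_ (Ordinal r2)); rewrite !mxE.
Qed.

Let frE i e : fr i e = \sum_j coef i 0 j * F (enum_val (maxrankfun M j)) e.
Proof. by rewrite /fr mxE; apply: eq_bigr => j _; rewrite !mxE enum_rankK. Qed.

Let fr_closed i v : \sum_e fr i e * ((src e == v)%:R + (tgt e == v)%:R) = 0.
Proof.
under eq_bigr => e _ do rewrite frE mulr_suml.
rewrite exchange_big big1 //= => j _.
by under eq_bigr => e _ do rewrite -mulrA; rewrite -mulr_sumr Fclosed mulr0.
Qed.

Let fr_lift j e : fr (lift ord0 j) e = F (enum_val (maxrankfun M j)) e.
Proof.
rewrite frE /coef liftK (bigD1 j) //= mxE !eqxx mul1r big1 ?addr0 // => j' ne.
by rewrite mxE (negPf ne) andbF mul0r.
Qed.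

Let fr_ord0 e : fr ord0 e = \sum_j fr (lift ord0 j) e.
Proof.
rewrite frE /coef unlift_none; apply: eq_bigr => j _.
by rewrite fr_lift mxE mul1r.
Qed.

(** An edge lies on at most two basis faces, hence on at most three faces with the outer one. Since
    all the faces add up to zero, the number is even. *)
Let fr_two e : #|[set i | fr i e != 0]| = 0%N \/ #|[set i | fr i e != 0]| = 2%N.
Proof.
set S := [set i | _].
have le3 : (#|S| <= 3)%N.
  have [k1 [k2 Hk]] := Ftwo e.
  pose A k := [set j | maxrankfun M j == enum_rank k].
  have cA k : (#|A k| <= 1)%N.
    apply/card_le1_eqP => x y; rewrite !inE => /eqP h /eqP h'.
    by apply: (@maxrankfun_inj _ _ _ M); rewrite h h'.
  have sub : S \subset ord0 |: (lift ord0 @: (A k1 :|: A k2)).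
    apply/fintype.subsetP => i; rewrite !inE; case: (unliftP ord0 i) => [j ->|-> //].
    rewrite fr_lift Hk => h; apply/orP; right; apply: imset_f; rewrite !inE.
    apply: contraNT h => /norP[]; rewrite -2!(can_eq enum_valK) !enum_rankK.
    by rewrite eq_sym => /negPf -> ; rewrite eq_sym => /negPf ->; rewrite addr0.
  apply: leq_trans (subset_leq_card sub) _.
  rewrite cardsU1 (card_imset _ (@lift_inj _ ord0)) cardsU.
  apply: (@leq_add _ _ 1 2); first exact: leq_b1.
  exact: leq_trans (leq_subr _ _) (leq_add (cA k1) (cA k2)).
have ev : ~~ odd #|S|.
  apply: F2_natr_eq0.
  have -> : #|S|%:R = \sum_i fr i e.
    rewrite -sum1_card natr_sum big_mkcond /=; apply: eq_bigr => i _.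
    by rewrite inE [RHS]F2_neq0; case: ifP.
  by rewrite big_ord_recl /= fr_ord0 F2addrr.
by move: le3 ev; case: #|S| => [|[|[|[|]]]] //; [left | right].
Qed.

Let face_rel (i : 'I_r.+1) : rel V :=
  fun x y => [exists e : edge, joins e x y && (fr i e != 0)].

Let face_relE i e x y : joins e x y -> face_rel i x y = (fr i e != 0).
Proof.
move=> xy; apply/existsP/idP => [[e' /andP[xy' h]]|h].
  by rewrite (joins_inj xy xy').
by exists e; rewrite xy.
Qed.

Let sum_joins e x : \sum_y (joins e x y)%:R = (src e == x)%:R + (tgt e == x)%:R :> 'F_2.
Proof.
have irr : src e != tgt e.
  by have /andP[a _] := valP e; apply/eqP => E; rewrite E adjI in a.
have -> : \sum_y (joins e x y)%:R =
   \sum_y ((src e == x)%:R * (tgt e == y)%:R + (tgt e == x)%:R * (src e == y)%:R) :> 'F_2.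
  apply: eq_bigr => y _; rewrite /joins; case: (val e) irr => u v /= uv.
  rewrite !xpair_eqE; case: eqP => [<-|_] /=.
    by rewrite mul1r [v == u]eq_sym (negPf uv) mul0r addr0 andbF orbF.
  by rewrite mul0r add0r andbC; do 2 case: eqP => _ //=; rewrite ?mul1r ?mul0r.
by rewrite big_split /= !sum_pick.
Qed.

Lemma face_system_exists : exists k (f : 'I_k -> rel V), face_system adj f.
Proof.
exists r.+1, face_rel; split.
- by move=> i x y; apply: eq_existsb => e; rewrite joinsC.
- by move=> i x y /existsP[e /andP[/joins_adj]].
- move=> i x; apply: F2_natr_eq0; rewrite -sum1_card natr_sum big_mkcond /=.
  rewrite -[RHS](fr_closed i x).
  under [RHS]eq_bigr => e _ do rewrite -sum_joins mulr_sumr.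
  rewrite exchange_big /=; apply: eq_bigr => y _; rewrite inE.
  have [/existsP[e xy]|/existsPn nxy] := boolP [exists e : edge, joins e x y].
    rewrite (face_relE i xy) (bigD1 e) //= xy mulr1 big1 ?addr0 => [|e' ne].
      by rewrite [RHS]F2_neq0; case: ifP.
    suff -> : joins e' x y = false by rewrite mulr0.
    by apply: contraNF ne => h; rewrite (joins_inj h xy).
  rewrite big1 => [|e _]; last by rewrite (negPf (nxy e)) mulr0.
  by case: ifP => // /existsP[e /andP[h]]; rewrite (negPf (nxy e)) in h.
- move=> i; have [/existsP[e he]|/existsPn h] := boolP [exists e, fr i e != 0].
    exists (src e), (tgt e); apply/existsP; exists e.
    by rewrite he /joins -surjective_pairing eqxx.
  have /negP[] := coef_neq0 i; apply/eqP/N_inj; rewrite mul0mx; apply/rowP => j.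
  by have := h (enum_val j); rewrite negbK /fr enum_valK mxE => /eqP ->; rewrite !mxE.
- move=> x y; have [/existsP[e xy]|/existsPn nxy] := boolP [exists e : edge, joins e x y].
    have -> : [set i | face_rel i x y] = [set i | fr i e != 0].
      by apply/finset.setP => i; rewrite !inE (face_relE i xy).
    exact: fr_two.
  left; apply/eqP; rewrite cards_eq0; apply/eqP/finset.setP => i; rewrite !inE.
  by apply/existsP => -[e /andP[h]]; rewrite (negPf (nxy e)) in h.
- move=> i j ij; apply: coef_inj; apply: N_inj; apply/rowP => k.
  rewrite -[k]enum_valK -!/(fr _ _) [LHS]F2_neq0 [RHS]F2_neq0.
  set e := enum_val k; have xy : joins e (src e) (tgt e).
    by rewrite /joins -surjective_pairing eqxx.
  by rewrite -!(face_relE _ xy) ij.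
- by rewrite sum_deg_edge; move: rank_M; rewrite -/r; lia.
Qed.

End FaceSystem.

End Edges.

Lemma grid_minor_face_system (V : finType) (adj : rel V) n
    (B : V -> {set 'I_n.+1 * 'I_n.+1}) :
  symmetric adj -> irreflexive adj ->
  (0 < #|V|)%N -> (#|V|.*2 < \sum_x #|[set y | adj x y]|)%N ->
  (forall x p, p \in B x -> inner_point p) ->
  (forall x y p, p \in B x -> p \in B y -> x = y) ->
  (forall x, set_connected (@grid n.+1) (B x)) ->
  (forall x y, adj x y -> exists p q, [/\ p \in B x, q \in B y & grid p q]) ->
  exists k (f : 'I_k -> rel V), face_system adj f.
Proof.
move=> adjC adjI V0 VE Bint Bdisj Bconn Badj.
have eadj (e : edge adj) : adj (val e).1 (val e).2 by have /andP[] := valP e.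
have /fin_all_exists[lp /fin_all_exists[lq H]] : forall e : edge adj, exists p q,
    [/\ p \in B (val e).1, q \in B (val e).2 & grid p q].
  by move=> e; exact: Badj.
have loopless (e : edge adj) : (val e).1 != (val e).2.
  by apply/eqP => E; move: (eadj e); rewrite E adjI.
have simple (e e' : edge adj) :
    ((val e).1 == (val e').1) && ((val e).2 == (val e').2)
    || ((val e).1 == (val e').2) && ((val e).2 == (val e').1) -> e = e'.
  move=> h; apply: (@joins_inj _ _ e e' (val e).1 (val e).2).
    by rewrite /joins -surjective_pairing eqxx.
  rewrite /joins; case: (val e) (val e') h => [a b] [c d] /=.
  by rewrite !xpair_eqE [c == a]eq_sym [d == b]eq_sym [c == b]eq_sym [d == a]eq_sym [(b == c) && _]andbC.
have lpB e : lp e \in B (val e).1 by have [] := H e.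
have lqB e : lq e \in B (val e).2 by have [] := H e.
have lpq e : grid (lp e) (lq e) by have [] := H e.
apply: (@face_system_exists V adj adjC adjI _
  (fun k e => face_side B lp lq k (lp e) (lq e))) => //.
- exact: (face_side_closed Bint Bdisj loopless simple lpB lqB lpq).
- by move=> e; exact: (face_side_two B lp lq e).
- exact: (cycle_is_face_sum Bint Bdisj Bconn loopless simple lpB lqB lpq).
- by rewrite -ltn_double -sum_deg_edge.
Qed.

(** * Weights received by a 5-vertex *)

(** A 2-regular graph on five vertices is a 5-cycle, because every component has at least three
    vertices. The walk e, a, b, c, d is followed until it must close. *)
Lemma link_cycle (T : finType) (L : rel T) (A : {set T}) :
  symmetric L -> irreflexive L -> #|A| = 5 ->
  (forall u w, L u w -> u \in A) ->
  (forall u w, L u w -> exists w', w' != w /\ L u =1 pred2 w w') ->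
  (forall u, u \in A -> exists w, L u w) ->
  forall a b, L a b -> exists c d e,
  [/\ uniq [:: a; b; c; d; e], A =i [:: a; b; c; d; e] &
   [/\ L a =1 pred2 b e, L b =1 pred2 a c, L c =1 pred2 b d, L d =1 pred2 c e
     & L e =1 pred2 d a]].
Proof.
move=> LC LI A5 LA L2 Lex a b ab.
have card_full (s : seq T) : uniq s -> {subset s <= A} -> size s = 5 -> A =i s.
  move=> us sA s5 x; have sub : s \subset A by apply/fintype.subsetP.
  have/eqP e : [set y in s] == A.
    rewrite eqEcard cardsE (card_uniqP us) s5 A5 leqnn andbT.
    by apply/fintype.subsetP => y; rewrite inE; exact: sA.
  by rewrite -e inE.
have fresh (s : seq T) : (size s < 5)%N -> exists2 x, x \in A & x \notin s.
  move=> s5; have : ~~ (A \subset s).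
    apply/negP => /subset_leq_card; rewrite A5 => h.
    by have := leq_trans h (card_size s); lia.
  by case/subsetPn => x; exists x.
have LN u w : L u w -> u != w by apply: contraTneq => ->; rewrite LI.
have LA' u w : L u w -> w \in A by rewrite LC; exact: LA.
have [e [eb La]] := L2 _ _ ab.
have ae : L a e by rewrite La /= eqxx orbT.
have ba : L b a by rewrite LC.
have [c [ca Lb]] := L2 _ _ ba.
have bc : L b c by rewrite Lb /= eqxx orbT.
have cb : L c b by rewrite LC.
have [d [db Lc]] := L2 _ _ cb.
have cd : L c d by rewrite Lc /= eqxx orbT.
have ea : L e a by rewrite LC.
(* If [a], [b], [c] formed a triangle, one of the two remaining vertices would need two neighbours
   among these two. *)
have ce : c != e.
  apply/eqP => E; subst e.
  have Lc' : L c =1 pred2 a b.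
    have cb' : b != a by rewrite eq_sym LN.
    have [w [wa Lw]] := L2 _ _ ea; have := cb; rewrite Lw /= (negPf cb') /= => /eqP bw.
    by move=> x; rewrite Lw /= bw.
  have [x xA xN] := fresh [:: a; b; c] isT.
  have [y xy] := Lex _ xA; have [z [zy Lx]] := L2 _ _ xy.
  have xz : L x z by rewrite Lx /= eqxx orbT.
  have out t : L x t -> t \notin [:: a; b; c].
    rewrite LC => tx; apply: contra xN; rewrite !inE => /or3P[] /eqP E; subst t.
    - by move: tx; rewrite La /= => /orP[] /eqP ->; rewrite !eqxx ?orbT.
    - by move: tx; rewrite Lb /= => /orP[] /eqP ->; rewrite !eqxx ?orbT.
    - by move: tx; rewrite Lc' /= => /orP[] /eqP ->; rewrite !eqxx ?orbT.
  have := out _ xy; have := out _ xz; have := LN _ _ xy; have := LN _ _ xz => xNz xNy zN yN.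
  have := @card_full [:: a; b; c; x; y].
  move: xN yN zN; rewrite !inE !negb_or => /and3P[xa xb xc] /and3P[ya yb yc] /and3P[za zb zc].
  have u : uniq [:: a; b; c; x; y].
    rewrite /= !inE !negb_or (LN _ _ ab) (LN _ _ ae) (LN _ _ bc) xNy.
    by rewrite ![_ == x]eq_sym ![_ == y]eq_sym xa ya xb yb xc yc.
  have sA : {subset [:: a; b; c; x; y] <= A}.
    move=> t; rewrite !inE => /or4P[/eqP->|/eqP->|/eqP->|/orP[]/eqP->] //.
    - exact: LA ab.
    - exact: LA ba.
    - exact: LA cb.
    - exact: LA' xy.
  move=> /(_ u sA erefl z); rewrite (LA' _ _ xz) !inE (negPf za) (negPf zb) (negPf zc).
  by rewrite eq_sym (negPf xNz) (negPf zy).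
have da : d != a.
  apply/eqP => E; subst d; have : L a c by rewrite LC.
  by rewrite La /= (negPf ce) orbF eq_sym (negPf (LN _ _ bc)).
have bd' : L b d = false by rewrite Lb /= (negPf da) eq_sym (negPf (LN _ _ cd)).
(* If [a], [b], [c], [e] formed a 4-cycle, the last vertex would have no neighbour left. *)
have de : d != e.
  apply/eqP => E; subst d.
  have Le : L e =1 pred2 a c.
    have [w [wa Lw]] := L2 _ _ ea.
    have : L e c by rewrite LC.
    by rewrite Lw /= (negPf ca) /= => /eqP cw x; rewrite Lw /= cw.
  have [x xA xN] := fresh [:: a; b; c; e] isT.
  have [y xy] := Lex _ xA.
  have u : uniq [:: a; b; c; e; x].
    move: xN; rewrite /= !inE !negb_or => /and4P[xa xb xc xe].
    rewrite (LN _ _ ab) (LN _ _ ae) (LN _ _ bc) ce ![_ == x]eq_sym xa xb xc xe.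
    by rewrite [a == c]eq_sym ca [b == e]eq_sym eb.
  have sA : {subset [:: a; b; c; e; x] <= A}.
    move=> t; rewrite !inE => /or4P[/eqP->|/eqP->|/eqP->|/orP[]/eqP->] //.
    - exact: LA ab.
    - exact: LA ba.
    - exact: LA cb.
    - exact: LA ea.
  have := card_full _ u sA erefl y; rewrite (LA' _ _ xy) !inE => /esym.
  have yx : L y x by rewrite LC.
  move: xN; rewrite !inE !negb_or => /and4P[xa xb xc xe].
  case/or4P=> [/eqP E|/eqP E|/eqP E|/orP[]/eqP E]; move: (yx); rewrite E ?La ?Lb ?Lc ?Le /=;
    rewrite ?(negPf xa) ?(negPf xb) ?(negPf xc) ?(negPf xe) //.
  by rewrite LI.
have u : uniq [:: a; b; c; d; e].
  rewrite /= !inE !negb_or (LN _ _ ab) (LN _ _ ae) (LN _ _ bc) (LN _ _ cd) ce de.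
  by rewrite [a == c]eq_sym ca [a == d]eq_sym da [b == d]eq_sym db [b == e]eq_sym eb.
have sA : {subset [:: a; b; c; d; e] <= A}.
  move=> t; rewrite !inE => /or4P[/eqP->|/eqP->|/eqP->|/orP[]/eqP->].
  - exact: LA ab.
  - exact: LA ba.
  - exact: LA cb.
  - exact: LA' cd.
  - exact: LA ea.
have AE := card_full _ u sA erefl.
have dc : L d c by rewrite LC.
have [w [wc Ld]] := L2 _ _ dc.
have dw : L d w by rewrite Ld /= eqxx orbT.
have we : w = e.
  have := LA' _ _ dw; rewrite AE !inE (negPf wc) /= [w == d]eq_sym (negPf (LN _ _ dw)) /=.
  case/or3P=> /eqP // E; move: dw; rewrite E LC ?bd' //.
  by rewrite La /= (negPf db) (negPf de).
subst w; exists c, d, e; split=> //; split=> //.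
have [w [wa Le]] := L2 _ _ ea.
have : L e d by rewrite LC.
by rewrite Le /= (negPf da) /= => /eqP dw' x; rewrite Le /= dw' orbC.
Qed.

(* The subtraction is truncated: vertices of degree 5 give nothing. *)
Definition W (n : nat) : rat := (n - 6)%N%:R / n%:R.

Definition not5 (n : nat) : rat := (n != 5)%:R.

(* What a 5-vertex receives when its neighbours have degrees [a, .., e] in
   cyclic order and all its faces are triangles. *)
Definition received (a b c d e : nat) : rat :=
  W a / 2 * (2 + (not5 b + not5 e)) + W b / 2 * (2 + (not5 a + not5 c)) +
  W c / 2 * (2 + (not5 b + not5 d)) + W d / 2 * (2 + (not5 c + not5 e)) +
  W e / 2 * (2 + (not5 d + not5 a)).

Lemma W_ge0 n : 0 <= W n.
Proof. by rewrite divr_ge0. Qed.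

Lemma W5 : W 5 = 0.
Proof. by rewrite /W mul0r. Qed.

Lemma WE n : (6 <= n)%N -> W n = 1 - 6 / n%:R.
Proof.
move=> n6; have n0 : n%:R != 0 :> rat by rewrite pnatr_eq0; lia.
by rewrite /W natrB //; field.
Qed.

(** The chord of the concave function 1 - 6 / n between 6 and [D]. Being linear, it turns a bound on
    the degree sum into one on the sum of the [W]. *)
Lemma W_chord D n : (0 < D)%N -> (5 <= n <= D)%N -> (n%:R - 6) / D%:R <= W n.
Proof.
move=> D0 /andP[n5 nD]; have D0' : 0 < D%:R :> rat by rewrite ltr0n.
have [n6|n6] := leqP 6 n.
  rewrite /W natrB //; apply: ler_wpM2l; first by rewrite subr_ge0 ler_nat.
  by rewrite lef_pV2 ?posrE ?ltr0n ?ler_nat //; lia.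
apply: le_trans (W_ge0 n); rewrite mulr_le0_ge0 ?invr_ge0 // subr_le0 ler_nat; lia.
Qed.

(** Here [q] is 1 / D and [x] is the chord. Since [x 5] is - q while [W 5] is 0, every neighbour of
    degree 5 improves the bound by [q]. Hiding the quotient in [x] keeps later goals linear. *)
Lemma W_chords D a b c d e : (16 <= D)%N -> (D + 24 <= a + b + c + d + e)%N ->
  all (fun n => 5 <= n <= D)%N [:: a; b; c; d; e] ->
  exists q : rat, [/\ 0 <= q, q <= 1 / 16 &
  exists x : nat -> rat, [/\ 1 - 6 * q <= x a + x b + x c + x d + x e,
    forall n, n \in [:: a; b; c; d; e] -> x n <= W n & x 5 = - q]].
Proof.
move=> D16 sum /and5P[ha hb hc hd /andP[he _]].
have D0 : (0 < D)%N by lia.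
exists D%:R^-1; split; first by rewrite invr_ge0.
  by rewrite mul1r lef_pV2 ?posrE ?ltr0n ?ler_nat.
exists (fun n => (n%:R - 6) / D%:R); split.
- rewrite -!mulrDl ler_pdivlMr ?ltr0n // mulrBl mul1r -mulrA mulVf ?mulr1; last first.
    by rewrite pnatr_eq0; lia.
  have : (D + 24)%:R <= (a + b + c + d + e)%:R :> rat by rewrite ler_nat.
  by rewrite !natrD; lra.
- by move=> n; rewrite !inE => /or4P[/eqP->|/eqP->|/eqP->|/orP[]/eqP->]; exact: W_chord.
- by have -> : 5%:R - 6 = -1 :> rat by []; rewrite mulN1r.
Qed.

Lemma not5_5 : not5 5 = 0. Proof. by []. Qed.

Lemma not5_6 n : (6 <= n)%N -> not5 n = 1.
Proof. by rewrite /not5; case: eqP => // ->. Qed.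

Lemma five_or_more n D : (5 <= n <= D)%N -> n = 5%N \/ (6 <= n)%N.
Proof. lia. Qed.

(** The case of three neighbours of degree 5, where the other two are not consecutive. By concavity
    the worst degrees are [D] and 9, giving 4 / 3 - 6 / D; this is below 1 exactly for D < 18, and
    equals 23 / 24 at D = 16. *)
Lemma two_far D a c : (16 <= D)%N -> (D + 9 <= a + c)%N -> (a <= D)%N -> (c <= D)%N ->
  1 <= W a + W c \/ [/\ (D <= 17)%N, (a == D) && (c == 9) || (a == 9) && (c == D) & 23 / 24 <= W a + W c].
Proof.
move=> D16 sum aD cD.
have a6 : (6 <= a)%N by lia.
have c6 : (6 <= c)%N by lia.
rewrite !WE //.
have a0 : 0 < a%:R :> rat by rewrite ltr0n; lia.
have c0 : 0 < c%:R :> rat by rewrite ltr0n; lia.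
have key (p q : nat) : (6 * p * (a + c) <= (p + q) * (a * c))%N ->
    (0 < p)%N -> 6 / a%:R + 6 / c%:R <= (p + q)%:R / p%:R :> rat.
  move=> h p0; have p0' : 0 < p%:R :> rat by rewrite ltr0n.
  have -> : 6 / a%:R + 6 / c%:R = 6 * (a + c)%:R / (a * c)%:R :> rat.
    by rewrite natrD natrM; field; rewrite (gt_eqF a0) (gt_eqF c0).
  rewrite ler_pdivrMr; last by rewrite natrM mulr_gt0.
  rewrite mulrAC ler_pdivlMr //.
  have : (6 * p * (a + c))%:R <= ((p + q) * (a * c))%:R :> rat by rewrite ler_nat.
  by rewrite !natrM; lra.
have [h|h] := leqP (6 * 1 * (a + c)) ((1 + 0) * (a * c)).
  by left; have := key 1%N 0%N h isT; rewrite divr1; lra.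
right.
have D17 : (D <= 17)%N by nia.
have ac : (a == D) && (c == 9) || (a == 9) && (c == D).
  have [a9|a9] := leqP a 9; first by lia.
  have [aD'|aD'] := ltnP a D; last by have aE : a = D by [lia]; subst a; nia.
  exfalso; have [s [t [aE DE]]] : exists s t, a = (10 + s)%N /\ D = (11 + s + t)%N.
    by exists (a - 10)%N, (D - a.+1)%N; lia.
  by nia.
split; [exact: D17 | exact: ac |].
(* 25 / 24 = 6 / 16 + 6 / 9 is the largest possible loss. *)
have := key 24%N 1%N; rewrite -[(24 + 1)%N]/25%N => k.
suff : 6 / a%:R + 6 / c%:R <= 25 / 24 :> rat by lra.
apply: k => //; case/orP: ac => /andP[/eqP E1 /eqP E2]; subst; lia.
Qed.

(** The case of two neighbours of degree 5 that separate [a] from the consecutive pair [c], [d];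
    each of these two sees the other and so counts 3 / 2 times. *)
Lemma one_and_pair D a c d : (16 <= D)%N -> (D + 14 <= a + c + d)%N ->
  (6 <= a <= D)%N -> (6 <= c)%N -> (6 <= d)%N ->
  1 <= W a + 3 / 2 * (W c + W d).
Proof.
move=> D16 sum /andP[a6 aD] c6 d6; rewrite !WE //.
set T := (c + d - 6)%N.
have TE : T%:R = c%:R + d%:R - 6 :> rat by rewrite /T natrB ?natrD //; lia.
have a0 : 0 < a%:R :> rat by rewrite ltr0n; lia.
have c0 : 6 <= c%:R :> rat by rewrite ler_nat.
have d0 : 6 <= d%:R :> rat by rewrite ler_nat.
have T0 : 0 < T%:R :> rat by rewrite TE; lra.
(* Equivalent to (a - 4) (T - 6) >= 24, with equality at D = 16 for a = 6 or a = D when the degree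
   sum is least. *)
have h : (4 * T + 6 * a <= a * T)%N by rewrite /T; nia.
have h1 : 4 / a%:R + 6 / T%:R <= 1 :> rat.
  have -> : 4 / a%:R + 6 / T%:R = (4 * T + 6 * a)%:R / (a * T)%:R :> rat.
    by rewrite natrD !natrM; field; rewrite (gt_eqF a0) (gt_eqF T0).
  by rewrite ler_pdivrMr ?mul1r ?ler_nat // natrM mulr_gt0.
(* Concavity: [W c + W d] does not increase when the pair is spread to 6 and [T]. *)
have h2 : 6 / c%:R + 6 / d%:R <= 1 + 6 / T%:R :> rat.
  rewrite TE; have c0' : 0 < c%:R :> rat by lra.
  have d0' : 0 < d%:R :> rat by lra.
  have t0' : 0 < c%:R + d%:R - 6 :> rat by lra.
  rewrite -subr_ge0.
  have -> : 1 + 6 / (c%:R + d%:R - 6) - (6 / c%:R + 6 / d%:R) =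
     (c%:R + d%:R) * (c%:R - 6) * (d%:R - 6) / (c%:R * d%:R * (c%:R + d%:R - 6)) :> rat.
    by field; rewrite (gt_eqF c0') (gt_eqF d0') (gt_eqF t0').
  apply: divr_ge0; last by rewrite !mulr_ge0 // ltW.
  by rewrite !mulr_ge0 ?subr_ge0 // addr_ge0 // ltW.
lra.
Qed.

Ltac nat_lia := repeat match goal with
  | H : is_true (Order.le _ _) |- _ => clear H
  | H : is_true (Order.lt _ _) |- _ => clear H
  end; lia.

(** The sixteen cases say which of [b], [c], [d], [e] have degree 5. All four is impossible as a <=
    D. Two non-consecutive large degrees fall under [two_far], an isolated one with a consecutive
    pair under [one_and_pair]; in all other cases the chord bounds suffice. *)
Lemma received_ge D a b c d e :
  (16 <= D)%N -> (D + 24 <= a + b + c + d + e)%N ->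
  all (fun n => 5 <= n <= D)%N [:: a; b; c; d; e] ->
  all (fun n => n <= a)%N [:: b; c; d; e] ->
  1 <= received a b c d e \/
  [/\ (D <= 17)%N, a = D, b = 5%N /\ e = 5%N, (c = 9%N /\ d = 5%N) \/ (c = 5%N /\ d = 9%N) &
      23 / 24 <= received a b c d e].
Proof.
move=> D16 sum ht; have [q [q0 q1 [x [xs xW x5]]]] := W_chords D16 sum ht.
case/and5P: ht => ha hb hc hd /andP[he _] /and5P[ba ca da ea _].
have xa := xW a; have xb := xW b; have xc := xW c; have xd := xW d; have xe := xW e.
rewrite !inE !eqxx ?orbT in xa xb xc xd xe.
have {}xa := xa isT; have {}xb := xb isT; have {}xc := xc isT.
have {}xd := xd isT; have {}xe := xe isT; clear xW.
have a0 := W_ge0 a; have b0 := W_ge0 b; have c0 := W_ge0 c.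
have d0 := W_ge0 d; have e0 := W_ge0 e.
have a6 : (6 <= a)%N by nat_lia.
rewrite /received (not5_6 a6).
case: (five_or_more hb) => [bE|b6]; case: (five_or_more hc) => [cE|c6];
case: (five_or_more hd) => [dE|d6]; case: (five_or_more he) => [eE|e6];
rewrite ?bE ?cE ?dE ?eE ?W5 ?not5_5 ?(not5_6 b6) ?(not5_6 c6) ?(not5_6 d6) ?(not5_6 e6);
rewrite ?bE ?cE ?dE ?eE ?x5 in xs xb xc xd xe.
- nat_lia.
- by left; clear -q0 q1 xs xa xb xc xd xe a0 b0 c0 d0 e0; lra.
- have sad : (D + 9 <= a + d)%N by nat_lia.
  have aD : (a <= D)%N by nat_lia.
  have dD : (d <= D)%N by nat_lia.
  have [h|[D17 ad h]] := two_far D16 sad aD dD; first by left; clear -h; lra.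
  by right; split; [exact: D17|nat_lia|by []|right; split; nat_lia|clear -h; lra].
- by left; clear -q0 q1 xs xa xb xc xd xe a0 b0 c0 d0 e0; lra.
- have sac : (D + 9 <= a + c)%N by nat_lia.
  have aD : (a <= D)%N by nat_lia.
  have cD : (c <= D)%N by nat_lia.
  have [h|[D17 ac h]] := two_far D16 sac aD cD; first by left; clear -h; lra.
  by right; split; [exact: D17|nat_lia|by []|left; split; nat_lia|clear -h; lra].
- have s3 : (D + 14 <= c + a + e)%N by nat_lia.
  have c6' : (6 <= c <= D)%N by nat_lia.
  by left; have h := one_and_pair D16 s3 c6' a6 e6; clear -h; lra.
- have s3 : (D + 14 <= a + c + d)%N by nat_lia.
  have a6' : (6 <= a <= D)%N by nat_lia.
  by left; have h := one_and_pair D16 s3 a6' c6 d6; clear -h; lra.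
- by left; clear -q0 q1 xs xa xb xc xd xe a0 b0 c0 d0 e0; lra.
- by left; clear -q0 q1 xs xa xb xc xd xe a0 b0 c0 d0 e0; lra.
- by left; clear -q0 q1 xs xa xb xc xd xe a0 b0 c0 d0 e0; lra.
- have s3 : (D + 14 <= d + a + b)%N by nat_lia.
  have d6' : (6 <= d <= D)%N by nat_lia.
  by left; have h := one_and_pair D16 s3 d6' a6 b6; clear -h; lra.
- by left; clear -q0 q1 xs xa xb xc xd xe a0 b0 c0 d0 e0; lra.
- by left; clear -q0 q1 xs xa xb xc xd xe a0 b0 c0 d0 e0; lra.
- by left; clear -q0 q1 xs xa xb xc xd xe a0 b0 c0 d0 e0; lra.
- by left; clear -q0 q1 xs xa xb xc xd xe a0 b0 c0 d0 e0; lra.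
- by left; clear -q0 q1 xs xa xb xc xd xe a0 b0 c0 d0 e0; lra.
Qed.

Lemma received_sum a b c d e :
  W a + W b + W c + W d + W e <= received a b c d e.
Proof.
have g n : 0 <= not5 n by rewrite ler0n.
rewrite /received.
have h u v w : W u <= W u / 2 * (2 + (not5 v + not5 w)).
  have := mulr_ge0 (W_ge0 u) (addr_ge0 (g v) (g w)); lra.
have := h a b e; have := h b a c; have := h c b d; have := h d c e; have := h e d a.
lra.
Qed.

(** Applies to a 5-neighbour next to the 9-vertex around a deficient vertex: three of its neighbours
    have degrees 5, 9, 5, which leaves D + 24 - 19 for [p + q]. The surplus is five times 1 / 24. *)
Lemma received_donor D p q : (16 <= D)%N -> (D <= 17)%N -> (D + 5 <= p + q)%N ->
  (5 <= p <= D)%N -> (5 <= q <= D)%N ->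
  1 + 5 / 24 <= received 5 9 p q 5 \/ p = 5%N /\ q = D.
Proof.
move=> D16 D17 sum hp hq.
case: (five_or_more hp) => [pE|p6]; first by right; lia.
left; have W9 : W 9 = 1 / 3 by rewrite WE //; lra.
have D0 : (0 < D)%N by nat_lia.
have D0' : 16 <= D%:R :> rat by rewrite ler_nat.
have sum' : D%:R + 5 <= p%:R + q%:R :> rat by rewrite -!natrD ler_nat.
have wp := W_chord D0 hp; have wq := W_chord D0 hq.
have p0 := W_ge0 p; have q0 := W_ge0 q.
have w2 : 9 / 16 <= (p%:R - 6) / D%:R + (q%:R - 6) / D%:R :> rat.
  by rewrite -mulrDl ler_pdivlMr; lra.
have B9 : not5 9 = 1 by [].
have D6 : (6 <= D)%N by exact: leq_trans D16.
rewrite /received W5 W9 (not5_6 p6) B9 not5_5.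
case: (five_or_more hq) => [qE|q6].
  rewrite qE W5 not5_5.
  have pD : p = D by nat_lia.
  have w2' : 10 / 16 <= W p.
    rewrite pD (WE D6).
    have : D%:R^-1 <= 16^-1 :> rat.
      by rewrite lef_pV2 ?posrE ?ltr0n ?ler_nat.
    by clear; lra.
  by clear -w2'; lra.
by rewrite (not5_6 q6); clear -wp wq w2 p0 q0; lra.
Qed.

(** * Discharging *)

Section Discharging.
Variables (V : finType) (adj : rel V) (k : nat) (f : 'I_k -> rel V).
Hypotheses (adjC : symmetric adj) (adjI : irreflexive adj) (fs : face_system adj f).

Definition degree (x : V) := #|[set y | adj x y]|.
Definition face_degree i x := #|[set y | f i x y]|.

(* Twice the number of edges of a face. *)
Definition darts i := (\sum_x face_degree i x)%N.
Definition triangular i := (darts i < 8)%N.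

Lemma face_irr i : irreflexive (f i).
Proof. by move=> x; apply/negP => /(face_sub fs); rewrite adjI. Qed.

Lemma face_neq i x y : f i x y -> x != y.
Proof. by apply: contraTneq => ->; rewrite face_irr. Qed.

Lemma face_other i x u : f i x u -> exists2 w, w != u & f i x w.
Proof.
move=> xu; have ev := face_even fs i x.
have uS : u \in [set y | f i x y] by rewrite inE.
have : (0 < #|[set y | f i x y] :\ u|)%N.
  by move: ev; rewrite (cardsD1 u) uS; case: #|_|.
by case/card_gt0P => w; rewrite !inE => /andP[wu xw]; exists w.
Qed.

Lemma darts_ge i (s : seq (V * V)) :
  uniq s -> all (fun p => f i p.1 p.2) s -> (size s <= darts i)%N.
Proof.
move=> us /allP sf.
have -> : darts i = #|[set p : V * V | f i p.1 p.2]|.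
  rewrite -sum1dep_card -(pair_big_dep xpredT (f i) (fun _ _ => 1%N)) /=.
  by apply: eq_bigr => x _; rewrite sum1dep_card.
rewrite -(card_uniqP us); apply: subset_leq_card; apply/fintype.subsetP => p ps.
by rewrite inE; exact: sf.
Qed.

(** A vertex on a face has at least two edges of it. If the ends [u], [w] of two edges at [x] were
    not joined in the face, their further edges would make four edges, that is 8 darts; so would any
    edge outside the triangle. *)
Lemma triangularP i x u : triangular i -> f i x u ->
  exists w, [/\ x != u, x != w, u != w &
    forall a b, f i a b = [&& a != b, a \in [:: x; u; w] & b \in [:: x; u; w]]].
Proof.
rewrite /triangular ltnNge => tri xu; have fC := face_sym fs i.
have [w wu xw] := face_other xu.
have ux : f i u x by rewrite fC.
have wx : f i w x by rewrite fC.
have [u' u'x uu'] := face_other ux; have [w' w'x ww'] := face_other wx.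
have big s : uniq s -> all (fun p => f i p.1 p.2) s -> (size s < 8)%N.
  by move=> us sf; rewrite ltnNge; apply: contra tri => h; apply: leq_trans h (darts_ge us sf).
have xNu := face_neq xu; have xNw := face_neq xw.
have six : uniq [:: (x, u); (u, x); (x, w); (w, x); (u, w); (w, u)].
  rewrite /= !inE !xpair_eqE !negb_or !negb_and !eqxx /=.
  by rewrite [u == x]eq_sym [w == x]eq_sym [u == w]eq_sym xNu xNw wu !orbT.
have uw : f i u w.
  have [<- //|u'w] := eqVneq u' w.
  have uNu' := face_neq uu'; have wNw' := face_neq ww'.
  have us : uniq [:: (x, u); (u, x); (x, w); (w, x); (u, u'); (u', u); (w, w'); (w', w)].
    have nE : ((x == u) = false) * ((u == x) = false) * ((x == w) = false) *
        ((w == x) = false) * ((u == w) = false) * ((w == u) = false) *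
        ((x == u') = false) * ((u' == x) = false) * ((x == w') = false) *
        ((w' == x) = false) * ((w == u') = false) * ((u' == w) = false) *
        ((u == u') = false) * ((u' == u) = false) * ((w == w') = false) * ((w' == w) = false).
      by do !split; apply/negbTE; rewrite // eq_sym.
    by rewrite /= !inE !xpair_eqE !nE ?andbF ?orbF /= ?nE ?andbF.
  have := big _ us; rewrite /= [f i u' u]fC [f i w' w]fC ux xu xw wx uu' ww' /=.
  by move=> /(_ isT).
have wu' : f i w u by rewrite fC.
exists w; split=> //; first by rewrite eq_sym.
move=> a b; apply/idP/and3P => [ab|[]]; last first.
  rewrite !inE => ab /or3P[]/eqP E /or3P[]/eqP E'; subst a b; rewrite ?eqxx // in ab.
suff H : (a, b) \in [:: (x, u); (u, x); (x, w); (w, x); (u, w); (w, u)].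
  split; first exact: face_neq ab.
    by move: H; rewrite !inE !xpair_eqE => /or4P[/andP[]|/andP[]|/andP[]|/or3P[]/andP[]] /eqP ->; rewrite eqxx ?orbT.
  by move: H; rewrite !inE !xpair_eqE => /or4P[/andP[]|/andP[]|/andP[]|/or3P[]/andP[]] _ /eqP ->; rewrite eqxx ?orbT.
apply: contraT => H.
have ba : f i b a by rewrite fC.
have H' : (b, a) \notin [:: (x, u); (u, x); (x, w); (w, x); (u, w); (w, u)].
  move: H; apply: contra; rewrite !inE !xpair_eqE.
  by case/or4P=> [/andP[]|/andP[]|/andP[]|/or3P[]/andP[]] /eqP -> /eqP ->; rewrite !eqxx ?orbT.
have us : uniq [:: (a, b), (b, a) & [:: (x, u); (u, x); (x, w); (w, x); (u, w); (w, u)]].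
  rewrite cons_uniq in_cons negb_or H cons_uniq H' six andbT.
  by rewrite xpair_eqE negb_and (face_neq ab).
have := big _ us; rewrite /= ab ba xu ux xw wx uw wu' /=.
by move=> /(_ isT).
Qed.

Definition uncovered (x : V) := #|[set u | adj x u && [forall i, ~~ f i x u]]|.

(** In a triangle the only candidate for [y] is the third vertex; not being a 5-vertex, it leaves
    its part to [x]. *)
Definition heavy i x u := [exists y, [&& f i u y, y != x & degree y != 5]].

(* Discharging: a vertex [u] of degree at least 7 splits its excess
   [degree u - 6] evenly among its pairs (incident edge, face along it). The
   part of the edge [ux] and a triangle [xuy] goes to [x], or to [y] if [y] is
   a 5-vertex and [x] is not. Faces with at least 4 edges give [1 / 4] per
   dart. *)
Definition share i x u : rat :=
  if triangular i then W (degree u) / 2 * (1 + (heavy i x u)%:R)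
  else 1 / 4 + W (degree u) / 2.

(** An edge on no face is missing from the dart counts, where it would count twice at each end; the
    2 makes up for this. *)
Definition charge x : rat :=
  2 * (uncovered x)%:R + \sum_i \sum_u (f i x u)%:R * share i x u.

Lemma face_degree_sum i u : (face_degree i u)%:R = \sum_x (f i x u)%:R :> rat.
Proof.
rewrite /face_degree -sum1_card natr_sum big_mkcond /=; apply: eq_bigr => x _.
by rewrite inE (face_sym fs); case: ifP.
Qed.

Lemma darts_ge6 i : (6 <= darts i)%N.
Proof.
have [x [u xu]] := face_nonempty fs i.
have [t|] := boolP (triangular i); last by rewrite -leqNgt; lia.
have [w [h1 h2 h3 fE]] := triangularP t xu.
apply: (@darts_ge i [:: (x, u); (u, x); (x, w); (w, x); (u, w); (w, u)]).
  rewrite /= !inE !xpair_eqE !negb_or !negb_and !eqxx /=.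
  by rewrite [u == x]eq_sym [w == x]eq_sym [w == u]eq_sym h1 h2 h3 !orbT.
by rewrite /= !fE !inE !eqxx !orbT [u == x]eq_sym [w == x]eq_sym [w == u]eq_sym h1 h2 h3.
Qed.

(** In a triangle the two parts of [u] go to the other two vertices or both to one of them, so
    nothing is created. A longer face can pay its darts from its own excess [darts i - 6]. *)
Lemma face_charge i :
  \sum_(x | degree x == 5) \sum_u (f i x u)%:R * share i x u <=
  (darts i)%:R - 6 + \sum_u (face_degree i u)%:R * (W (degree u) / 2).
Proof.
have W2 u : 0 <= W (degree u) / 2 by rewrite divr_ge0 ?W_ge0.
have d6 : 6 <= (darts i)%:R :> rat by rewrite ler_nat darts_ge6.
rewrite /share; have [t|nt] := boolP (triangular i).
  suff H : \sum_(x | degree x == 5) \sum_u (f i x u)%:R * (W (degree u) / 2 * (1 + (heavy i x u)%:R))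
     <= \sum_u (face_degree i u)%:R * (W (degree u) / 2).
    by apply: le_trans H _; rewrite lerDr subr_ge0.
  rewrite exchange_big /=; apply: ler_sum => u _.
  under eq_bigr => x _ do rewrite mulrCA.
  rewrite -mulr_sumr mulrC; apply: ler_wpM2r => //.
  rewrite big_mkcond /=.
  have [/existsP[x ux]|/existsPn nu] := boolP [exists x, f i u x]; last first.
    rewrite big1 ?ler0n // => x _; case: ifP => // _.
    by rewrite (face_sym fs) (negPf (nu x)) mul0r.
  have [w [h1 h2 h3 fE]] := triangularP t ux.
  have fu y : f i y u = (y == x) || (y == w).
    rewrite fE !inE eqxx /= andbT; case: eqP => [->|_] /=; last by [].
    by rewrite (negPf h1) (negPf h2).
  have hx : heavy i x u = (degree w != 5).
    apply/existsP/idP => [[y /and3P[]]|dw].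
      by rewrite (face_sym fs) fu => /orP[]/eqP -> //; rewrite eqxx.
    by exists w; rewrite (face_sym fs) fu eqxx orbT eq_sym h3.
  have hw : heavy i w u = (degree x != 5).
    apply/existsP/idP => [[y /and3P[]]|dw].
      by rewrite (face_sym fs) fu => /orP[]/eqP -> //; rewrite eqxx.
    by exists x; rewrite (face_sym fs) fu eqxx h3.
  rewrite face_degree_sum [X in _ <= X](bigD1 x) // (bigD1 w) //=; last by rewrite eq_sym.
  rewrite [X in X <= _](bigD1 x) // [X in _ + X <= _](bigD1 w) //=; last by rewrite eq_sym.
  rewrite big1 => [|y /andP[/negPf y1 /negPf y2]]; last first.
    by rewrite fu y1 y2 mul0r; case: ifP.
  rewrite [X in _ <= _ + (_ + X)]big1 => [|y /andP[/negPf y1 /negPf y2]]; last by rewrite fu y1 y2.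
  rewrite !fu !eqxx orbT hx hw /= !mul1r.
  by case: (degree x == 5); case: (degree w == 5).
(* Exactly what makes 1 / 4 per dart affordable: darts / 4 <= darts - 6. *)
have d8 : 8 <= (darts i)%:R :> rat by rewrite ler_nat leqNgt.
apply: (@le_trans _ _ (\sum_x \sum_u (f i x u)%:R * (1 / 4 + W (degree u) / 2))).
  rewrite [X in X <= _]big_mkcond /=; apply: ler_sum => x _; case: ifP => // _.
  apply: sumr_ge0 => u _; apply: mulr_ge0; first exact: ler0n.
  by apply: addr_ge0 (W2 u); exact: divr_ge0 ler01 (ler0n _ 4).
rewrite exchange_big /=.
under eq_bigr => u _ do rewrite -mulr_suml -face_degree_sum mulrDr.
rewrite big_split /= -mulr_suml -natr_sum -/(darts i).
move: (\sum_u _) => s; lra.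
Qed.

Hypothesis deg5 : forall x, (5 <= degree x)%N.

(** Three times Euler's inequality: the sum of [degree x - 6] over the vertices, of [darts i - 6]
    over the faces and of 2 per end of an edge on no face is at most -12. A 5-vertex has excess -1,
    whence [charge x - 1]. *)
Lemma total_charge : \sum_(x | degree x == 5) (charge x - 1) <= - 12%:R.
Proof.
have cover x u : (\sum_i (f i x u)%:R : rat) =
    2 * (adj x u)%:R - 2 * (adj x u && [forall i, ~~ f i x u])%:R.
  have -> : \sum_i (f i x u)%:R = #|[set i | f i x u]|%:R :> rat.
    rewrite -sum1_card natr_sum [RHS]big_mkcond /=; apply: eq_bigr => i _.
    by rewrite inE; case: ifP.
  have [xu|nxu] := boolP (adj x u); last first.
    suff -> : [set i | f i x u] = finset.set0 by rewrite cards0 mulr0 subr0.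
    by apply/finset.setP => i; rewrite !inE; apply: contraNF nxu; exact: (face_sub fs).
  case: (face_two fs x u) => h; rewrite h.
    have -> : [forall i, ~~ f i x u].
      by apply/forallP => i; move/eqP: h; rewrite cards_eq0 => /eqP/finset.setP/(_ i); rewrite !inE => ->.
    by rewrite subrr.
  suff -> : [forall i, ~~ f i x u] = false by rewrite mulr0 subr0 mulr1.
  apply/negP => /forallP H; move: h; rewrite (_ : [set i | f i x u] = finset.set0) ?cards0 //.
  by apply/finset.setP => i; rewrite !inE (negPf (H i)).
have fd x : \sum_i (face_degree i x)%:R = 2 * (degree x)%:R - 2 * (uncovered x)%:R :> rat.
  under eq_bigr => i _ do rewrite face_degree_sum.
  rewrite exchange_big /=; under eq_bigr => u _ do under eq_bigr => i _ do rewrite (face_sym fs).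
  under eq_bigr => u _ do rewrite cover.
  rewrite sumrB -!mulr_sumr; congr (_ * _ - _ * _).
    rewrite /degree -sum1_card natr_sum [RHS]big_mkcond /=; apply: eq_bigr => u _.
    by rewrite inE; case: ifP.
  rewrite /uncovered -sum1_card natr_sum [RHS]big_mkcond /=; apply: eq_bigr => u _.
  by rewrite inE; case: ifP.
have Wd u : W (degree u) * (degree u)%:R = (degree u)%:R - 6 + (degree u == 5)%:R.
  have d0 : (degree u)%:R != 0 :> rat by rewrite pnatr_eq0; have := deg5 u; lia.
  rewrite /W mulfVK //; have [d5|d5] := eqVneq (degree u) 5%N; first by rewrite d5.
  by rewrite addr0 natrB //; have := deg5 u; lia.
rewrite sumrB; set n5 := \sum_(x | _) 1; rewrite /charge big_split /= exchange_big /=.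
have n5E : n5 = \sum_x (degree x == 5)%:R.
  by rewrite /n5 big_mkcond /=; apply: eq_bigr => x _; case: ifP.
have h1 : \sum_(x | degree x == 5) 2 * (uncovered x)%:R <= \sum_x 2 * (uncovered x)%:R :> rat.
  rewrite [X in X <= _]big_mkcond; apply: ler_sum => x _; case: ifP => // _.
  exact: (mulr_ge0 (ler0n rat 2) (ler0n rat _)).
have h2 : \sum_i \sum_(x | degree x == 5) \sum_u (f i x u)%:R * share i x u <=
    \sum_i ((darts i)%:R - 6 + \sum_u (face_degree i u)%:R * (W (degree u) / 2)).
  by apply: ler_sum => i _; exact: face_charge.
have h3 : \sum_i ((darts i)%:R - 6 + \sum_u (face_degree i u)%:R * (W (degree u) / 2)) <=
    \sum_x (2 * (degree x)%:R - 2 * (uncovered x)%:R) - 6 * k%:R +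
    \sum_x ((degree x)%:R - 6 + (degree x == 5)%:R).
  rewrite big_split /= sumrB sumr_const card_ord -[_ *+ k]mulr_natr.
  have -> : \sum_(i < k) (darts i)%:R = \sum_x (2 * (degree x)%:R - 2 * (uncovered x)%:R) :> rat.
    under eq_bigr => i _ do rewrite /darts natr_sum.
    by rewrite exchange_big /=; apply: eq_bigr => x _; rewrite fd.
  apply: lerD => //; rewrite exchange_big /=; apply: ler_sum => u _.
  rewrite -mulr_suml fd -Wd.
  have := mulr_ge0 (ler0n rat (uncovered u)) (W_ge0 (degree u)); move: (W _) => w; lra.
have eu : \sum_x (degree x)%:R + 4 <= 2 * (#|V|%:R + k%:R) :> rat.
  have := face_euler fs; rewrite -(ler_nat rat) natrD natr_sum -mul2n natrM natrD.
  by [].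
have s1 : \sum_x (2 * (degree x)%:R - 2 * (uncovered x)%:R) =
    2 * (\sum_x (degree x)%:R) - 2 * \sum_x (uncovered x)%:R :> rat.
  by rewrite sumrB -!mulr_sumr.
have s2 : \sum_x ((degree x)%:R - 6 + (degree x == 5)%:R) =
    \sum_x (degree x)%:R - 6 * #|V|%:R + n5 :> rat.
  by rewrite big_split /= sumrB sumr_const -[_ *+ _]mulr_natr n5E.
rewrite s1 s2 in h3; rewrite -!mulr_sumr in h1.
have h4 := le_trans h2 h3; rewrite -mulr_sumr.
clear -h1 h4 eu.
lra.
Qed.
End Discharging.

(** * Charge received by a single vertex *)

Section Local.
Variables (V : finType) (adj : rel V) (k : nat) (f : 'I_k -> rel V).
Hypotheses (adjC : symmetric adj) (adjI : irreflexive adj) (fs : face_system adj f).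
Local Notation degree := (degree adj).
Local Notation uncovered := (uncovered adj f).
Local Notation triangular := (triangular f).
Local Notation share := (share adj f).
Local Notation charge := (charge adj f).
Local Notation triangularP := (triangularP adjI fs).

Definition flat x :=
  (uncovered x == 0) && [forall i, forall u, f i x u ==> triangular i].

Definition link x u w := [exists i, [&& triangular i, f i x u, f i x w & u != w]].

Lemma share_ge i x u :
  W (degree u) / 2 + (~~ triangular i)%:R / 4 <= share i x u.
Proof.
have w2 : 0 <= W (degree u) / 2 by apply: divr_ge0 (ler0n _ 2); exact: W_ge0.
rewrite /share; case: triangular => /=; last by lra.
have := mulr_ge0 w2 (ler0n rat (heavy adj f i x u)); lra.
Qed.

Lemma share_ge0 i x u : 0 <= share i x u.
Proof.
apply: le_trans (share_ge i x u); apply: addr_ge0.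
  by apply: divr_ge0 (ler0n _ 2); exact: W_ge0.
by apply: divr_ge0 (ler0n _ 4); exact: ler0n.
Qed.

Lemma charge_uncovered x : uncovered x != 0%N -> 2 <= charge x.
Proof.
move=> u0; have u1 : 1 <= (uncovered x)%:R :> rat by rewrite ler1n lt0n.
have s0 : 0 <= \sum_i \sum_u (f i x u)%:R * share i x u.
  apply: sumr_ge0 => i _; apply: sumr_ge0 => u _; apply: mulr_ge0 (share_ge0 _ _ _).
  exact: ler0n.
rewrite /charge; lra.
Qed.

Lemma covered_two x u : uncovered x = 0%N -> adj x u -> #|[set i | f i x u]| = 2%N.
Proof.
move=> u0 xu; case: (face_two fs x u) => // h.
have : u \in [set u | adj x u && [forall i, ~~ f i x u]].
  rewrite inE xu; apply/forallP => i; move/eqP: h; rewrite cards_eq0 => /eqP/finset.setP/(_ i).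
  by rewrite !inE => ->.
by move/eqP: u0; rewrite cards_eq0 => /eqP ->; rewrite inE.
Qed.

Lemma charge_swap x : uncovered x = 0%N ->
  charge x = \sum_(u | adj x u) \sum_(i | f i x u) share i x u.
Proof.
move=> u0; rewrite /charge u0 mulr0 add0r exchange_big [RHS]big_mkcond /=.
apply: eq_bigr => u _; case: ifP => [_|/negP nxu].
  by rewrite [RHS]big_mkcond /=; apply: eq_bigr => i _; case: (f i x u); rewrite ?mul1r ?mul0r.
rewrite big1 // => i _; have -> : f i x u = false by apply/negP => /(face_sub fs).
by rewrite mul0r.
Qed.

(** A long face through [x] has at least two darts there, worth 1 / 4 each; every edge lies on two
    faces, and each passes on at least half of [W]. *)
Lemma charge_not_flat x : uncovered x = 0%N -> ~~ flat x ->
  1 / 2 + \sum_(u | adj x u) W (degree u) <= charge x.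
Proof.
move=> u0; rewrite /flat u0 eqxx /= => /forallPn[i /forallPn[u]].
rewrite negb_imply => /andP[xu nt].
have [w wu xw] := face_other fs xu.
have s2 : \sum_(u | adj x u) W (degree u) =
    \sum_(u | adj x u) \sum_(i | f i x u) W (degree u) / 2.
  apply: eq_bigr => v xv; rewrite sumr_const.
  have -> : #|[pred i | f i x v]| = 2%N.
    by rewrite -(covered_two u0 xv); apply: eq_card => j; rewrite !inE.
  by rewrite -[_ / 2 *+ 2]mulr_natr divfK ?pnatr_eq0.
have s1 : 1 / 2 <= \sum_(u | adj x u) \sum_(i | f i x u) (~~ triangular i)%:R / 4 :> rat.
  have q0 j : 0 <= (~~ triangular j)%:R / 4 :> rat by apply: divr_ge0 (ler0n _ 4); exact: ler0n.
  have sub v : f i x v -> 1 / 4 <= \sum_(i | f i x v) (~~ triangular i)%:R / 4 :> rat.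
    have t1 : (~~ triangular i)%:R = 1 :> rat by rewrite nt.
    move=> xv; rewrite (bigD1 i) //= t1; have : 0 <= \sum_(j | f j x v && (j != i)) (~~ triangular j)%:R / 4 :> rat.
      by apply: sumr_ge0 => j _.
    move: (\sum_(j | _) _) => s; lra.
  rewrite (bigD1 u) ?(face_sub fs xu) //= (bigD1 w) /=; last by rewrite (face_sub fs xw).
  have := sub _ xu; have := sub _ xw.
  have : 0 <= \sum_(v | adj x v && (v != u) && (v != w)) \sum_(i | f i x v) (~~ triangular i)%:R / 4 :> rat.
    by apply: sumr_ge0 => v _; apply: sumr_ge0.
  move: (\sum_(v | _) _) (\sum_(j | f j x u) _) (\sum_(j | f j x w) _) => a b c; lra.
rewrite (charge_swap u0) s2; apply: le_trans (lerD s1 (lexx _)) _.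
rewrite -big_split /=; apply: ler_sum => v _; rewrite -big_split /=.
by apply: ler_sum => j _; rewrite addrC; exact: share_ge.
Qed.

Lemma linkC x : symmetric (link x).
Proof.
move=> u w; apply: eq_existsb => i; rewrite eq_sym.
by case: (f i x u); case: (f i x w); rewrite ?andbF.
Qed.

Lemma linkI x : irreflexive (link x).
Proof. by move=> u; apply/existsP => -[i]; rewrite eqxx !andbF. Qed.

Lemma link_adj x u w : link x u w -> adj x u.
Proof. by case/existsP=> i /and4P[_ /(face_sub fs)]. Qed.

Lemma link_rot x u w : link x u w -> link u x w.
Proof.
case/existsP=> i /and4P[t xu xw uw]; apply/existsP; exists i.
have [v [h1 h2 h3 fE]] := triangularP t xu.
have wv : w = v.
  by move: xw; rewrite fE !inE eq_sym => /and3P[/negPf -> _]; rewrite /= [w == u]eq_sym (negPf uw) => /eqP.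
by rewrite t (face_sym fs) xu wv fE !inE !eqxx !orbT h3 h2.
Qed.

(** The two triangles on [xu] are distinct faces, hence have distinct third vertices. These are the
    two neighbours of [u] in the link of [x]. *)
Lemma flat_link x u : flat x -> adj x u -> exists w w', [/\ w != w',
  link x u =1 pred2 w w' &
  \sum_(i | f i x u) share i x u =
    W (degree u) / 2 * (2 + (not5 (degree w) + not5 (degree w')))].
Proof.
case/andP=> /eqP u0 /forallP ft xu.
have tri i : f i x u -> triangular i.
  by move=> h; have /forallP/(_ u) := ft i; rewrite h.
have /eqP/cards2P[i [j [ij E]]] := covered_two u0 xu.
have iE l : f l x u = (l == i) || (l == j).
  by have /finset.setP/(_ l) := E; rewrite !inE.
have xui : f i x u by rewrite iE eqxx.
have xuj : f j x u by rewrite iE eqxx orbT.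
have [w [_ xw uw fi]] := triangularP (tri _ xui) xui.
have [w' [xu' xw' uw' fj]] := triangularP (tri _ xuj) xuj.
have ww' : w != w'.
  apply: contra_neq ij => E'; apply: (face_inj fs) => a b.
  by rewrite fi fj E'.
have thirdE l v (z : V) : x != z -> u != z ->
    (forall a b, f l a b = [&& a != b, a \in [:: x; u; z] & b \in [:: x; u; z]]) ->
    (f l x v && (u != v)) = (v == z).
  move=> xz uz fl; rewrite fl !inE eqxx /=.
  have [->|vz] := eqVneq v z; first by rewrite !orbT xz uz.
  have [->|vx] := eqVneq v x; first by [].
  by case: (eqVneq v u).
have heavyE l z : x != z -> u != z ->
    (forall a b, f l a b = [&& a != b, a \in [:: x; u; z] & b \in [:: x; u; z]]) ->
    (heavy adj f l x u)%:R = not5 (degree z).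
  move=> xz uz fl; suff -> : heavy adj f l x u = (degree z != 5%N) by [].
  apply/existsP/idP => [[y /and3P[]]|dz].
    rewrite fl !inE => /and3P[uy _]; rewrite [y == u]eq_sym (negPf uy) /=.
    by case/orP=> /eqP -> //; rewrite eqxx.
  by exists z; rewrite fl !inE !eqxx !orbT uz eq_sym xz dz.
exists w, w'; split=> //.
  move=> v; apply/existsP/idP => [[l /and4P[tl xul xvl uv]]|].
    have := xul; rewrite iE => /orP[]/eqP E'; subst l.
      by rewrite /= -(thirdE i v w) ?xvl ?uv.
    by rewrite /= -(thirdE j v w') ?xvl ?uv ?orbT.
  rewrite /= => /orP[] h; [exists i|exists j].
    by move: h; rewrite -(thirdE i v w) // => /andP[-> ->]; rewrite xui tri.
  by move: h; rewrite -(thirdE j v w') // => /andP[-> ->]; rewrite xuj tri.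
rewrite (bigD1 i) //= (bigD1 j) /=; last by rewrite xuj eq_sym.
rewrite big1 ?addr0 => [|l /andP[/andP[]]]; last by rewrite iE => /orP[] ->.
rewrite /share !tri // (heavyE i w) // (heavyE j w') // -mulrDr; congr (_ * _).
by rewrite addrACA.
Qed.

(** Supplies the cyclic order of the neighbours, starting with any prescribed consecutive pair [a],
    [b]. *)
Lemma flat_cycle x a b : flat x -> degree x = 5%N -> link x a b ->
  exists c d e,
  [/\ uniq [:: a; b; c; d; e], adj x =1 mem [:: a; b; c; d; e],
   [/\ link x b c, link x c d, link x d e & link x e a],
   [/\ link x a =1 pred2 b e & link x b =1 pred2 a c] &
   charge x = received (degree a) (degree b) (degree c) (degree d) (degree e)].
Proof.
move=> fx d5 ab; pose A := [set y | adj x y].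
have [|||c [d [e [us AE [La Lb Lc Ld Le]]]]] := @link_cycle _ (link x) A (@linkC x) (@linkI x) d5 _ _ _ a b ab.
- by move=> u w /link_adj; rewrite inE.
- move=> u w uw; have [v [v' [vv' L _]]] := flat_link fx (link_adj uw).
  have := uw; rewrite L => /orP[]/eqP E; subst w.
    by exists v'; rewrite eq_sym.
  by exists v; split=> // t; rewrite L /= orbC.
- move=> u; rewrite inE => /(flat_link fx)[v [v' [_ L _]]].
  by exists v; rewrite L /= eqxx.
exists c, d, e; split=> //.
- by move=> y; have := AE y; rewrite inE.
- by split; rewrite ?Lb ?Lc ?Ld ?Le /= eqxx ?orbT.
have u0 : uncovered x = 0%N by case/andP: fx => /eqP.
have sh u v w : u \in A -> v != w -> link x u =1 pred2 v w ->
    \sum_(i | f i x u) share i x u =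
    W (degree u) / 2 * (2 + (not5 (degree v) + not5 (degree w))).
  rewrite inE => uA vw L; have [p [q [pq L' ->]]] := flat_link fx uA.
  have Lp : pred2 v w p by rewrite -L L' /= eqxx.
  have Lq : pred2 v w q by rewrite -L L' /= eqxx orbT.
  case/orP: Lp Lq pq => /eqP -> /orP[]/eqP ->; rewrite ?eqxx // => _.
  by rewrite [X in 2 + X]addrC.
rewrite charge_swap // (eq_bigl (mem [:: a; b; c; d; e])) => [|y]; last by have := AE y; rewrite inE.
rewrite -big_uniq; last exact: us. rewrite !big_cons big_nil /= addr0 /received.
have inA t : t \in [:: a; b; c; d; e] -> t \in A by rewrite AE.
move: us; rewrite /= !inE !negb_or => /and5P[/and4P[n1 n2 n3 n4] /and3P[n5 n6 n7] /andP[n8 n9] n10 _].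
rewrite (sh a b e) ?inA ?inE ?eqxx ?orbT // (sh b a c) ?inA ?inE ?eqxx ?orbT //.
rewrite (sh c b d) ?inA ?inE ?eqxx ?orbT // (sh d c e) ?inA ?inE ?eqxx ?orbT //.
rewrite (sh e d a) ?inA ?inE ?eqxx ?orbT //; last by rewrite eq_sym.
by rewrite !addrA.
Qed.

End Local.

(** * Contradiction when all 5-stars are heavy *)

Section HeavyStars.
Variables (V : finType) (adj : rel V) (k : nat) (f : 'I_k -> rel V) (D : nat).
Hypotheses (adjC : symmetric adj) (adjI : irreflexive adj) (fs : face_system adj f).
Local Notation degree := (degree adj).
Local Notation charge := (charge adj f).
Local Notation flat := (flat adj f).
Local Notation link := (link f).
Hypotheses (D16 : (16 <= D)%N) (deg5 : forall x, (5 <= degree x)%N)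
  (degD : forall x, (degree x <= D)%N)
  (heavy_star : forall c, degree c = 5%N -> (D + 24 <= \sum_(u | adj c u) degree u)%N).

(** The chords give 1 - (6 - m) / D, which is smallest at D = 16. *)
Lemma sum_W_ge x (m : nat) : degree x = 5%N ->
  (m <= #|[set u | adj x u & degree u == 5]|)%N -> (m <= 2)%N ->
  10 / 16 + m%:R / 16 <= \sum_(u | adj x u) W (degree u).
Proof.
move=> dx m5 m2; have D0 : (0 < D)%N by exact: leq_trans D16.
have Dp : 0 < D%:R :> rat by rewrite ltr0n.
have Dge : 16 <= D%:R :> rat by rewrite ler_nat.
have term u : ((degree u)%:R - 6 + (degree u == 5)%:R) / D%:R <= W (degree u).
  have [->|_] := eqVneq (degree u) 5%N.
    have -> : (5%:R - 6 + true%:R : rat) = 0 by [].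
    by rewrite mul0r; exact: W_ge0.
  by rewrite addr0; apply: W_chord; rewrite // deg5 degD.
apply: le_trans (ler_sum _ (fun u _ => term u)).
rewrite -mulr_suml ler_pdivlMr; last by exact: Dp.
rewrite big_split /= sumrB sumr_const.
have -> : #|[pred u | adj x u]| = 5%N by rewrite -dx /degree cardsE.
have h1 : D%:R + 24 <= \sum_(u | adj x u) (degree u)%:R :> rat.
  by rewrite -natr_sum -natrD ler_nat; exact: heavy_star.
have h2 : m%:R <= \sum_(u | adj x u) (degree u == 5)%:R :> rat.
  apply: (@le_trans _ _ (#|[set u | adj x u & degree u == 5]|%:R)); first by rewrite ler_nat.
  rewrite -sum1_card natr_sum [X in X <= _]big_mkcond [X in _ <= X]big_mkcond /=.
  apply: ler_sum => u _; rewrite inE.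
  by case: (adj x u); case: (degree u == 5).
have m0 : 0 <= m%:R :> rat by exact: ler0n.
have m2' : m%:R <= 2 :> rat by rewrite ler_nat.
have -> : 6 *+ 5 = 30 :> rat by [].
have : (m%:R - 6) * (D%:R - 16) <= 0 :> rat.
  by rewrite mulr_le0_ge0 // ?subr_ge0 // subr_le0; apply: le_trans m2' _.
move: (\sum_(u | _) _) h1 (\sum_(u | _) _) h2 => s h1 t h2.
lra.
Qed.

Lemma flat_or_rich x : degree x = 5%N -> 1 <= charge x \/ flat x.
Proof.
move=> dx; have [u0|u0] := eqVneq (uncovered adj f x) 0%N; last first.
  by left; have := charge_uncovered u0; lra.
have [fx|nf] := boolP (flat x); [by right | left].
have h := @sum_W_ge x 0 dx (leq0n _) isT; have := charge_not_flat fs u0 nf.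
by move: h; move: (\sum_(u | _) _) => s; lra.
Qed.

(** Without flatness the charge is at least 1 / 2 + 12 / 16 = 5 / 4. A single 5-neighbour would
    guarantee only 19 / 16, just short of 29 / 24. *)
Lemma flat_or_donor x c z : degree x = 5%N -> c != z -> adj x c -> adj x z ->
  degree c = 5%N -> degree z = 5%N -> 1 + 5 / 24 <= charge x \/ flat x.
Proof.
move=> dx cz xc xz dc dz; have [u0|u0] := eqVneq (uncovered adj f x) 0%N; last first.
  by left; have := charge_uncovered u0; lra.
have [fx|nf] := boolP (flat x); [by right | left].
have two : (2 <= #|[set u | adj x u & degree u == 5%N]|)%N.
  apply: (@leq_trans #|[set c; z]|); first by rewrite cards2 cz.
  apply: subset_leq_card; apply/fintype.subsetP => u; rewrite !inE.
  by case/orP=> /eqP ->; rewrite ?xc ?xz ?dc ?dz.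
have h := sum_W_ge dx two isT; have := charge_not_flat fs u0 nf.
by move: h; move: (\sum_(u | _) _) => s; lra.
Qed.

Definition donor y := (degree y == 5%N) && (1 + 5 / 24 <= charge y).

Lemma sum_cycle (x a b c d e : V) : uniq [:: a; b; c; d; e] ->
  adj x =1 mem [:: a; b; c; d; e] ->
  (\sum_(u | adj x u) degree u = degree a + degree b + degree c + degree d + degree e)%N.
Proof.
move=> us xE; rewrite (eq_bigl _ _ xE) -big_uniq; last exact: us.
by rewrite !big_cons big_nil /= addn0 !addnA.
Qed.

(* The neighbours of [c] are [v], a fifth vertex, [w], [y], [z] in cyclic order.
   If [y] is not a donor, it sees a second vertex of degree [D], which is also
   adjacent to [z] and hence makes [z] a donor. *)
Lemma bad_has_donor c v w y z : (D <= 17)%N -> degree c = 5%N ->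
  link c w y -> link c y z -> link c z v ->
  degree v = D -> degree w = 9%N -> degree y = 5%N -> degree z = 5%N ->
  donor y \/ donor z.
Proof.
move=> D17 dc wy yz zv dv dw dy dz.
have rot := link_rot adjI fs; have LC := @linkC V k f.
have ladj x u u' : link x u u' -> adj x u by exact: (link_adj fs).
have yc_w : link y c w by apply: rot; rewrite LC.
have yc_z : link y c z by apply: rot.
have zc_y : link z c y by apply: rot; rewrite LC.
have zc_v : link z c v by apply: rot.
have cz : c != z.
  by apply/eqP => E; have := ladj _ _ _ zv; rewrite E adjI.
have cy : c != y.
  by apply/eqP => E; have := ladj _ _ _ yz; rewrite E adjI.
have yz' : adj y z by rewrite LC in yc_z; exact: ladj yc_z.
rewrite /donor dy dz !eqxx /=.
have [|fy] := flat_or_donor dy cz (ladj _ _ _ yc_w) yz' dc dz; first by left.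
have [p [q [e [us yE [wp pq qe ec] [Lc Lw] chE]]]] := flat_cycle adjI fs fy dy yc_w.
have ez : e = z.
  have := yc_z; rewrite Lc => /orP[]/eqP E //.
  by move: dw; rewrite -E dz.
subst e; have := sum_cycle us yE; rewrite dc dw dz => sE.
have := heavy_star dy; rewrite sE => hs.
have [||||[pE qE]] := @received_donor D (degree p) (degree q) D16 D17.
- by clear -hs; lia.
- by rewrite deg5 degD.
- by rewrite deg5 degD.
- by rewrite chE dc dw dz => h; left.
(* The second vertex [q] of degree [D] comes next to [z] around [y], so [z], [y], [q] span a
   triangle. *)
have zy_q : link z y q by apply: rot; rewrite LC.
have [|fz] := flat_or_donor dz cy (ladj _ _ _ zc_v) (ladj _ _ _ zy_q) dc dy; first by right.
have [p' [q' [e [us' zE _ [Lc' Ly'] chE']]]] := flat_cycle adjI fs fz dz zc_y.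
have ev : e = v.
  have := zc_v; rewrite Lc' => /orP[]/eqP E //.
  by move: D16; rewrite -dv E dy.
have pq' : p' = q.
  have := zy_q; rewrite Ly' => /orP[]/eqP E //.
  by move: us; rewrite E /= !inE !eqxx ?orbT ?andbF.
(* Now [v] and [q] occupy two places around [z], and already 2 [W D] >= 20 / 16 > 29 / 24. *)
right; rewrite chE' ev pq' qE dv.
apply: le_trans (received_sum _ _ _ _ _).
have WD : 10 / 16 <= W D.
  rewrite WE; last exact: leq_trans D16.
  have : D%:R^-1 <= 16^-1 :> rat.
    by rewrite lef_pV2 ?posrE ?ltr0n ?ler_nat; [exact: D16|exact: leq_trans D16|].
  by move: D%:R => d; lra.
have := W_ge0 (degree c); have := W_ge0 (degree y); have := W_ge0 (degree q').
lra.
Qed.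

Lemma rich_or_has_donor c : degree c = 5%N ->
  1 <= charge c \/ 23 / 24 <= charge c /\ exists2 y, adj c y & donor y.
Proof.
move=> dc; have [|fc] := flat_or_rich dc; first by left.
have /card_gt0P[u0] : (0 < #|[set u | adj c u]|)%N by rewrite -/(degree c) dc.
rewrite inE => cu0.
have [a ca amax] : exists2 a, adj c a & forall u, adj c u -> (degree u <= degree a)%N.
  by case: (arg_maxnP (fun u => degree u) cu0) => a ca amax; exists a.
have [b [b' [_ La _]]] := flat_link adjI fs fc ca.
have ab : link c a b by rewrite La /= eqxx.
have [p [q [e [us cE [bp pq qe ea] [Laa Lb] chE]]]] := flat_cycle adjI fs fc dc ab.
have inE' u : u \in [:: a; b; p; q; e] -> adj c u by rewrite cE.
have := heavy_star dc; rewrite (sum_cycle us cE) => hs.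
have [||h|[D17 aD [b5 e5] pq9 ch]] := received_ge D16 hs.
- by rewrite /= !deg5 !degD.
- by rewrite /= !amax //; apply: inE'; rewrite !inE eqxx ?orbT.
- by left; rewrite chE.
right; rewrite chE; split; first exact: ch.
have LC := @linkC V k f.
case: pq9 => [[p9 q5]|[p5 q9]].
  have [dn|dn] := bad_has_donor D17 dc pq qe ea aD p9 q5 e5.
    by exists q; [apply: inE'; rewrite !inE eqxx ?orbT | exact: dn].
  by exists e; [apply: inE'; rewrite !inE eqxx ?orbT | exact: dn].
(* The mirror image: the same pattern read in the opposite direction around [c]. *)
rewrite LC in pq; rewrite LC in bp; rewrite LC in ab.
have [dn|dn] := bad_has_donor D17 dc pq bp ab aD q9 p5 b5.
  by exists p; [apply: inE'; rewrite !inE eqxx ?orbT | exact: dn].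
by exists b; [apply: inE'; rewrite !inE eqxx ?orbT | exact: dn].
Qed.

Lemma heavy_stars_absurd : False.
Proof.
pose F : rat := \sum_(x | degree x == 5%N) (charge x - 1).
have : F <= - 12%:R by apply: total_charge.
suff : 0 <= F by lra.
(* Donors give 1 / 24 to each 5-neighbour, donors included; [gift] and [load] count in units of 1 /
   24 what [x] gets and gives. *)
pose gift x : rat := \sum_(y | donor y) (adj x y)%:R.
pose load x : rat := (donor x)%:R * \sum_(y | degree y == 5%N) (adj x y)%:R.
have balance : \sum_(x | degree x == 5%N) gift x = \sum_(x | degree x == 5%N) load x.
  rewrite /gift exchange_big /= [RHS]big_mkcond [LHS]big_mkcond /=.
  apply: eq_bigr => x _; rewrite /load /donor; case: (degree x == 5%N); last by [].
  rewrite andTb; case: ifP => _; last by rewrite mul0r.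
  rewrite mul1r.
  by apply: eq_bigr => y _; rewrite adjC.
have -> : F = \sum_(x | degree x == 5%N) (charge x - 1 + gift x / 24 - load x / 24).
  rewrite sumrB big_split /= -!mulr_suml balance.
  by rewrite -addrA subrr addr0.
apply: sumr_ge0 => x /eqP dx.
have g0 : 0 <= gift x by apply: sumr_ge0 => y _; exact: ler0n.
have [dn|ndn] := boolP (donor x).
  have lo : load x <= 5.
    rewrite /load dn mul1r -dx /degree -sum1_card natr_sum.
    rewrite [X in X <= _]big_mkcond [X in _ <= X]big_mkcond /=.
    apply: ler_sum => y _; rewrite inE; case: (adj x y) => /=; case: (_ == _) => //.
  have /andP[_ ch] := dn; lra.
have -> : load x = 0 by rewrite /load (negPf ndn) mul0r.
have [ch|[ch [y xy dy]]] := rich_or_has_donor dx; first lra.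
have : 1 <= gift x.
  rewrite /gift (bigD1 y dy) xy lerDl.
  by apply: sumr_ge0 => z _; exact: ler0n.
lra.
Qed.

End HeavyStars.

Require Import Defs.
From mathcomp Require Import all_classical all_reals all_analysis.
Import numFieldNormedType.Exports.

(** * Grid minors from plane drawings *)

Section Topology.
Local Open Scope classical_set_scope.

Lemma prod_norm_le (R : realType) (a : R * R) (r : R) :
  (`|a| <= r) = (`|a.1| <= r) && (`|a.2| <= r).
Proof. by rewrite [`|a|]/(Num.max _ _) ge_max. Qed.

Lemma ball_prodE (R : realType) (u v : R * R) (d : R) :
  ball u d v = (`|u - v| < d) :> Prop.
Proof.
have -> : `|u - v| = Num.max `|u.1 - v.1| `|u.2 - v.2| by [].
by rewrite gt_max propeqE; split=> [[? ?] | /andP[]] *; [apply/andP|]; split.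
Qed.

(** The set of differences is compact, hence closed, and misses 0. *)
Lemma compact_gap (R : realType) (A B : set (R * R)) :
  compact A -> compact B -> A `&` B = set0 ->
  exists2 d : R, 0 < d & forall a b, A a -> B b -> d <= `|a - b|.
Proof.
move=> cA cB AB0.
pose f (p : (R * R) * (R * R)) := p.1 - p.2.
have cf : continuous f by move=> p; apply: cvgB; [exact: cvg_fst | exact: cvg_snd].
have cI : compact (f @` (A `*` B)).
  apply: continuous_compact; last exact: compact_setX.
  exact: continuous_subspaceT.
have oI := closed_openC (compact_closed (@norm_hausdorff R (R * R)%type) cI).
have /nbhs_ballP[d /= d0 sub] : nbhs (0 : R * R) (~` (f @` (A `*` B))).
  apply: open_nbhs_nbhs; split=> // -[[a b] /= [Aa Bb] ab0].
  have ab : a = b by apply/eqP; rewrite -subr_eq0; exact/eqP.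
  by move: AB0; rewrite -subset0 => /(_ a); apply; split=> //=; rewrite ab.
exists d => // a b Aa Bb; rewrite leNgt; apply/negP => lt.
have := sub (a - b); apply; last by exists (a, b).
by rewrite ball_prodE sub0r normrN.
Qed.

(** Since [Q] is preserved by steps shorter than [d] in both directions, it is open and closed
    relative to [A]. *)
Lemma connected_chain (R : realType) (A : set (R * R)) (d : R)
    (Q : R * R -> Prop) (a b : R * R) :
  connected A -> 0 < d ->
  (forall u v, A u -> A v -> `|u - v| < d -> Q u -> Q v) ->
  A a -> A b -> Q a -> Q b.
Proof.
move=> cA d0 step Aa Ab Qa.
have ballE (u v : R * R) : ball u d v = (`|u - v| < d) :> Prop by exact: ball_prodE.
suff : A `&` Q = A by move=> E; have [] : (A `&` Q) b by rewrite E.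
apply: cA; first by exists a.
- exists (\bigcup_(u in A `&` Q) ball u d).
    by apply: bigcup_open => u _; exact: ball_open.
  apply/seteqP; split=> v [Av].
    by move=> Qv; split=> //; exists v => //; exact: ballxx.
  by case=> u [Au Qu]; rewrite ballE => uv; split=> //; exact: (step u).
- exists (~` (\bigcup_(u in A `&` ~` Q) ball u d)).
    by apply: open_closedC; apply: bigcup_open => u _; exact: ball_open.
  apply/seteqP; split=> v [Av].
    move=> Qv; split=> // -[u [Au nQu]]; rewrite ballE => uv.
    by apply: nQu; apply: (step v) => //; rewrite distrC.
  move=> nU; split=> //; apply: contrapT => nQ; apply: nU.
  by exists v => //; exact: ballxx.
Qed.

Lemma arc_compact (R : realType) (A : set (R * R)) p q : is_arc A p q -> compact A.
Proof.
by case=> g [cg _ _ _ ->]; apply: continuous_compact => //; exact: segment_compact.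
Qed.

Lemma arc_connected (R : realType) (A : set (R * R)) p q : is_arc A p q -> connected A.
Proof.
case=> g [cg _ _ _ ->]; apply: connected_continuous_connected => //.
exact: segment_connected.
Qed.

Lemma arc_ends (R : realType) (A : set (R * R)) p q : is_arc A p q -> A p /\ A q.
Proof.
by case=> g [_ _ <- <- ->]; split; [exists 0 | exists 1] => //=;
  rewrite in_itv /= ?lexx ?ler01.
Qed.

Lemma finite_gap (R : realType) (T : finType) (P : T -> R -> Prop) :
  (forall t, exists2 d, 0 < d & P t d) ->
  (forall t d d', 0 < d' <= d -> P t d -> P t d') ->
  exists2 d, 0 < d & forall t, P t d.
Proof.
move=> ex mono.
have /choice[f Hf] : forall t, exists d, 0 < d /\ P t d.
  by move=> t; have [d] := ex t; exists d.
pose m := \big[Num.min/1]_t f t.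
have m0 : 0 < m by apply: lt_bigmin => // t _; have [] := Hf t.
exists m => // t; have [f0 Pt] := Hf t; apply: mono Pt.
by rewrite m0; exact: bigmin_le_cond.
Qed.

(** * Rounding to a fine grid *)

Section Rounding.
Variables (R : realType) (n : nat) (M d : R).
Hypothesis d0 : 0 < d.

Definition gpoint (p : 'I_n * 'I_n) : R * R := (p.1%:R * d - M, p.2%:R * d - M).

(** Balls of the maximum norm are products of intervals, so their grid points form a rectangle. *)
Lemma box_connected (a : R * R) (r : R) (U : {set 'I_n * 'I_n}) p q :
  (forall s, `|gpoint s - a| <= r -> s \in U) ->
  `|gpoint p - a| <= r -> `|gpoint q - a| <= r ->
  connect (rel_in (@grid n) U) p q.
Proof.
move=> sub; rewrite !prod_norm_le => /andP[p1 p2] /andP[q1 q2].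
pose I (c : R) : pred nat := fun i => `|i%:R * d - M - c| <= r.
have cI c i j k : (i <= k <= j)%N -> I c i -> I c j -> I c k.
  case/andP; rewrite -(ler_nat R) -(ler_nat R k) /I !ler_norml => ik kj.
  have := ler_wpM2r (ltW d0) ik; have := ler_wpM2r (ltW d0) kj.
  by move=> ? ? /andP[? ?] /andP[? ?]; apply/andP; split; lra.
have := @rect_connected n (I a.1) (I a.2) p q (cI _) (cI _) p1 p2 q1 q2.
apply: connect_rel_in_sub; apply/fintype.subsetP => s; rewrite inE => /andP[s1 s2].
by apply: sub; rewrite prod_norm_le; apply/andP.
Qed.

Lemma round_exists (a : R * R) : `|a| <= M -> M + M < n%:R * d ->
  exists p, `|gpoint p - a| <= d.
Proof.
rewrite prod_norm_le => /andP[a1 a2] Mn.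
have coord (x : R) : `|x| <= M -> exists i : 'I_n, `|i%:R * d - M - x| <= d.
  rewrite ler_norml => /andP[x1 x2].
  have y0 : 0 <= (x + M) / d by rewrite divr_ge0 ?(ltW d0) //; lra.
  have /andP[t1 t2] := Num.Theory.truncn_itv y0.
  rewrite ler_pdivlMr // in t1; rewrite ltr_pdivrMr // -natr1 mulrDl mul1r in t2.
  have tn : (Num.truncn ((x + M) / d) < n)%N.
    by rewrite -(ltr_nat R) -(ltr_pM2r d0); lra.
  by exists (Ordinal tn); rewrite /= ler_norml; apply/andP; split; lra.
have [i Hi] := coord _ a1; have [j Hj] := coord _ a2.
by exists (i, j); rewrite prod_norm_le; apply/andP.
Qed.

Lemma gpoint_interior p : `|gpoint p| < M -> M + M < n.-1%:R * d ->
  (0 < p.1 < n.-1)%N /\ (0 < p.2 < n.-1)%N.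
Proof.
move=> pM Mn.
have coord (i : nat) : `|i%:R * d - M| < M -> (0 < i < n.-1)%N.
  rewrite ltr_norml => /andP[i1 i2]; apply/andP; split.
    by rewrite -(ltr_nat R) -(ltr_pM2r d0) mul0r; lra.
  by rewrite -(ltr_nat R) -(ltr_pM2r d0); lra.
have : `|gpoint p| = Num.max `|(gpoint p).1| `|(gpoint p).2| by [].
by move=> E; move: pM; rewrite E gt_max => /andP[h1 h2]; split; exact: coord.
Qed.

End Rounding.

(** * Distances between vertices and arcs of a drawing *)

Section PlaneGaps.
Variables (R : realType) (G : plane_graph R).
Local Notation arc := (@edge_arc R G).
Local Notation at_ := (@pos R G).

Lemma vertex_gap :
  exists2 d : R, 0 < d & forall v w : G, v != w -> d <= `|at_ v - at_ w|.
Proof.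
have [||d d0 H] := @finite_gap R (G * G)%type
  (fun t d => t.1 != t.2 -> d <= `|at_ t.1 - at_ t.2|).
- move=> [v w] /=; have [->|vw] := eqVneq v w; first by exists 1.
  exists `|at_ v - at_ w| => //.
  by rewrite normr_gt0 subr_eq0; apply: contra_neq vw => /pos_inj.
- by move=> t d d' /andP[_ dd] H /H; exact: le_trans.
by exists d => // v w; exact: (H (v, w)).
Qed.

Lemma arc_vertex_gap : exists2 d : R, 0 < d &
  forall x y z : G, adj x y -> z != x -> z != y ->
    forall a, arc x y a -> d <= `|a - at_ z|.
Proof.
have [||d d0 H] := @finite_gap R (G * G * G)%type
  (fun t d => adj t.1.1 t.1.2 -> t.2 != t.1.1 -> t.2 != t.1.2 ->
    forall a, arc t.1.1 t.1.2 a -> d <= `|a - at_ t.2|).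
- move=> [[x y] z] /=; have [xy|] := boolP (adj x y); last by exists 1.
  have [->|zx] := eqVneq z x; first by exists 1.
  have [->|zy] := eqVneq z y; first by exists 1.
  have [|||d d0 H] := @compact_gap R (arc x y) [set at_ z].
  + exact: arc_compact (edge_arcP xy).
  + exact: compact_set1.
  + rewrite -subset0 => a /= [] /[swap] -> /(edge_arc_vertex xy).
    by case=> /eqP; rewrite ?(negPf zx) ?(negPf zy).
  by exists d => // _ _ _ a Aa; exact: H.
- by move=> t d d' /andP[_ dd] H h1 h2 h3 a Aa; apply: le_trans dd (H _ _ _ _ Aa).
by exists d => // x y z; exact: (H (x, y, z)).
Qed.

(** Distinct arcs meet only at vertex positions, and those on [arc x y] are its ends. Removing open
    balls around the ends leaves a compact set disjoint from the other arc. *)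
Lemma arc_arc_gap (s : R) : 0 < s -> exists2 d : R, 0 < d &
  forall x y z t : G, adj x y -> adj z t -> [set x; y]%SET != [set z; t]%SET ->
    forall a b, arc x y a -> arc z t b ->
    s <= `|a - at_ x| -> s <= `|a - at_ y| -> d <= `|a - b|.
Proof.
move=> s0.
have [||d d0 H] := @finite_gap R (G * G * (G * G))%type
  (fun q d => adj q.1.1 q.1.2 -> adj q.2.1 q.2.2 ->
    [set q.1.1; q.1.2]%SET != [set q.2.1; q.2.2]%SET ->
    forall a b, arc q.1.1 q.1.2 a -> arc q.2.1 q.2.2 b ->
    s <= `|a - at_ q.1.1| -> s <= `|a - at_ q.1.2| -> d <= `|a - b|).
- move=> [[x y] [z t]] /=.
  have [xy|] := boolP (adj x y); last by exists 1.
  have [zt|] := boolP (adj z t); last by exists 1.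
  have [E|ne] := eqVneq [set x; y]%SET [set z; t]%SET; first by exists 1.
  pose far v : set (R * R) := ~` ball (at_ v) s.
  have cfar v : closed (far v) by apply: open_closedC; exact: ball_open.
  have farE v (a : R * R) : s <= `|a - at_ v| -> far v a.
    by move=> le; rewrite /far /= ball_prodE distrC => /(le_lt_trans le); rewrite ltxx.
  have [|||d d0 H] := @compact_gap R (arc x y `&` (far x `&` far y)) (arc z t).
  + apply: compact_closedI; last exact: closedI.
    exact: arc_compact (edge_arcP xy).
  + exact: arc_compact (edge_arcP zt).
  + rewrite -subset0 => a /= [[Aa [fx fy]] Ba].
    have [v _ va] := edge_arc_cross xy zt ne (conj Aa Ba).
    move: Aa; rewrite -va => /(edge_arc_vertex xy)[] vE.
      by apply: fx; rewrite -va vE; exact: ballxx.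
    by apply: fy; rewrite -va vE; exact: ballxx.
  by exists d => // _ _ _ a b Aa Bb sx sy; apply: H => //; split=> //; split; exact: farE.
- move=> q d d' /andP[_ dd] H h1 h2 h3 a b Aa Bb sx sy.
  by apply: le_trans dd (H _ _ _ _ _ Aa Bb sx sy).
by exists d => // x y z t; exact: (H ((x, y), (z, t))).
Qed.

Lemma plane_bounded : exists M : R,
  (forall v : G, `|at_ v| <= M) /\
  (forall x y : G, adj x y -> forall a, arc x y a -> `|a| <= M).
Proof.
(* A common upper bound is obtained as the inverse of a common positive lower bound. *)
have [||d d0 H] := @finite_gap R (G * G)%type
  (fun t d => d * `|at_ t.1| <= 1 /\
     (adj t.1 t.2 -> forall a, arc t.1 t.2 a -> d * `|a| <= 1)).
- move=> [x y] /=.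
  have [A [cA Ax sub]] : exists A : set (R * R), [/\ compact A, A (at_ x) &
      adj x y -> arc x y `<=` A].
    have [xy|_] := boolP (adj x y); last first.
      by exists [set at_ x]; split=> //; exact: compact_set1.
    have aP := edge_arcP xy; have [Ax _] := arc_ends aP.
    exists (arc x y); split=> [|//|_ a //]; exact: arc_compact aP.
  have /pinfty_ex_gt0[M M0 HM] := compact_bounded cA.
  have bound a : A a -> M^-1 * `|a| <= 1.
    by move=> Aa; rewrite mulrC ler_pdivrMr // mul1r; exact: HM.
  exists M^-1; first by rewrite invr_gt0.
  by split=> [|xy a Aa]; apply: bound => //; exact: sub.
- move=> t d d' /andP[_ dd] [h1 h2]; split=> [|xy a Aa].
    by apply: le_trans h1; exact: ler_wpM2r.
  by apply: le_trans (h2 xy a Aa); exact: ler_wpM2r.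
exists d^-1; split=> [v|x y xy a Aa]; rewrite -[d^-1]mul1r ler_pdivlMr // mulrC.
  by have [] := H (v, v).
by have [_] := H (x, y); apply.
Qed.

End PlaneGaps.

(* Branch sets: the grid points in a small box around each vertex [x], together
   with those met by a discretized arc [xy], with [x] before [y], until it
   enters the box of [y]. *)
Lemma plane_grid_minor (R : realType) (G : plane_graph R) :
  exists n (B : G -> {set 'I_n.+1 * 'I_n.+1}),
    [/\ forall x p, p \in B x -> (0 < p.1 < n)%N /\ (0 < p.2 < n)%N,
        forall x y p, p \in B x -> p \in B y -> x = y,
        forall x, set_connected (@grid n.+1) (B x) &
        forall x y, adj x y -> exists p q, [/\ p \in B x, q \in B y & grid p q]].
Proof.
have [r1 r10 gapV] := vertex_gap G.
have [r2 r20 gapA] := arc_vertex_gap G.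
have [M [MV MA]] := plane_bounded G.
pose r := Num.min (Num.min r1 r2) 1 / 8%:R.
have r_le z : Num.min (Num.min r1 r2) 1 <= z -> 8%:R * r <= z.
  by move=> h; rewrite mulrC /r mulfVK.
have r0 : 0 < r by rewrite divr_gt0 // !lt_min r10 r20 ltr01.
have rr1 : 8%:R * r <= r1 by apply: r_le; rewrite !ge_min lexx.
have rr2 : 8%:R * r <= r2 by apply: r_le; rewrite !ge_min lexx orbT.
have rr3 : 8%:R * r <= 1 by apply: r_le; rewrite !ge_min lexx orbT.
(* If a grid point outside the boxes of both ends is within 2 d of a point of the arc, that point is
   at least r - 2 d >= r / 2 from the ends. *)
have [d3 d30 gapE] := @arc_arc_gap R G (r / 2%:R) (divr_gt0 r0 (ltr0n _ 2)).
pose d := Num.min r d3 / 8%:R.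
have d0 : 0 < d by rewrite divr_gt0 // !lt_min r0 d30.
have d_le z : Num.min r d3 <= z -> 8%:R * d <= z.
  by move=> h; rewrite mulrC /d mulfVK.
have dr : 8%:R * d <= r by apply: d_le; rewrite !ge_min lexx.
have dd3 : 8%:R * d <= d3 by apply: d_le; rewrite !ge_min lexx orbT.
(* The margin 1 keeps all boxes and thickened arcs off the border of the grid. *)
pose N := M + 1.
pose n := (Num.truncn ((N + N) / d)).+1.
have nN : N + N < n%:R * d.
  by rewrite -ltr_pdivrMr //; exact: Num.Theory.truncnS_gt.
have n1N : N + N < n.+1%:R * d.
  by apply: lt_trans nN _; rewrite ltr_pM2r // ltr_nat.
pose gp := @gpoint R n.+1 N d.
have tri (a b c : R * R) : `|a - c| <= `|a - b| + `|b - c|.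
  exact: ler_distD.
have tri' (a b c : R * R) : `|a - c| <= `|b - a| + `|b - c|.
  by rewrite (distrC b); exact: ler_distD.
have close (a b c : R * R) (s t : R) : `|b - a| <= s -> `|b - c| <= t -> `|a - c| <= s + t.
  by move=> ba bc; apply: le_trans (tri' a b c) _; exact: lerD.
have away (a b c : R * R) (s t : R) : `|b - a| <= s -> t < `|b - c| -> t - s <= `|a - c|.
  by move=> ba bc; have := tri b a c; lra.
have round a : `|a| <= M -> exists p, `|gp p - a| <= d.
  by move=> aM; apply: round_exists => //; rewrite /N; lra.
have /choice[c Hc] : forall x : G, exists p, `|gp p - pos x| <= d.
  by move=> x; exact: round.
pose box (x : G) : {set 'I_n.+1 * 'I_n.+1} := [set p | `|gp p - pos x| <= r]%SET.
(* The radius is 2 d because a point of the arc rounds to a grid point within d, which is still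
   within 2 d of all arc points at distance less than d. *)
pose U (x y : G) : {set 'I_n.+1 * 'I_n.+1} :=
  [set p | `[< exists2 a, edge_arc x y a & `|gp p - a| <= 2%:R * d >]]%SET.
pose C (x y : G) : {set 'I_n.+1 * 'I_n.+1} :=
  [set p | connect (rel_in (@grid n.+1) (U x y :\: box y)) (c x) p]%SET.
pose B (x : G) : {set 'I_n.+1 * 'I_n.+1} := box x :|:
  \bigcup_(y | adj x y && (enum_rank x < enum_rank y)%N) C x y.
have cbox x : c x \in box x.
  by rewrite inE; apply: le_trans (Hc x) _; lra.
have boxN x y p : x != y -> p \in box x -> p \notin box y.
  move=> xy; rewrite !inE => px; apply/negP => py.
  by have := gapV _ _ xy; have := tri' (pos x) (gp p) (pos y); clear xy; lra.
have cU x y : adj x y -> c x \in U x y.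
  move=> xy; rewrite inE; apply/asboolP; have [Ax _] := arc_ends (edge_arcP xy).
  by exists (pos x) => //; have := Hc x; lra.
have neq (x y : G) : adj x y -> x != y.
  by move=> xy; apply/eqP => E; move: xy; rewrite E adj_irrefl.
have cC x y : adj x y -> c x \in U x y :\: box y.
  move=> xy; rewrite finset.in_setD cU // andbT.
  exact: boxN _ _ _ (neq _ _ xy) (cbox x).
have CU x y p : adj x y -> p \in C x y -> p \in U x y :\: box y.
  move=> xy; rewrite inE => /connectP[s]; elim/last_ind: s => [|s q _] /=.
    by move=> _ ->; exact: cC.
  by rewrite rcons_path last_rcons => /andP[_ /and3P[_ _ ?]] ->.
have arc_conn x y : adj x y -> connect (rel_in (@grid n.+1) (U x y)) (c x) (c y).
  move=> xy; have aP := edge_arcP xy; have [Ax Ay] := arc_ends aP.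
  have inU a p : edge_arc x y a -> `|gp p - a| <= 2%:R * d -> p \in U x y.
    by move=> Aa pa; rewrite inE; apply/asboolP; exists a.
  (* Reachability of all grid points near [a] is carried along the arc by steps shorter than d. *)
  pose Q a := forall p, `|gp p - a| <= 2%:R * d ->
    connect (rel_in (@grid n.+1) (U x y)) (c x) p.
  have := @connected_chain R (edge_arc x y) d Q (pos x) (pos y) (arc_connected aP) d0.
  apply=> //; last by have := Hc y; lra.
    move=> u v Au Av uv Qu p pv.
    have [m mu] := round u (MA _ _ xy _ Au).
    have mv : `|gp m - v| <= 2%:R * d by have := tri (gp m) u v; lra.
    apply: connect_trans (Qu m _) _; first by lra.
    by apply: (box_connected (M := N) d0 (a := v) (r := 2%:R * d)) => // s; exact: inU.
  move=> p px; apply: (box_connected (M := N) d0 (a := pos x) (r := 2%:R * d)) => //.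
    by move=> s; exact: inU.
  by have := Hc x; lra.
exists n, B; split.
- move=> x p pB; apply: (gpoint_interior (n := n.+1) d0 (M := N)) => //.
  have near_M a : `|a| <= M -> `|gp p - a| <= r -> `|gp p| < N.
    move=> aM pa; have := tri (gp p) a 0; rewrite !subr0 /N; lra.
  move: pB; rewrite inE => /orP[|/bigcupP[y /andP[xy _] /(CU _ _ _ xy)]].
    by rewrite inE; apply: near_M.
  rewrite !inE => /andP[_ /asboolP[a Aa pa]].
  by apply: near_M (MA _ _ xy _ Aa) _; lra.
- have boxC x y z p : adj x y -> p \in C x y -> p \in box z -> z = x.
    move=> xy /(CU _ _ _ xy); rewrite finset.in_setD => /andP[py].
    rewrite inE => /asboolP[a Aa pa] pz.
    have [//|zx] := eqVneq z x; have [zy|zy] := eqVneq z y; first by rewrite zy (negPf py) in pz.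
    rewrite inE in pz.
    have h : r2 <= 2%:R * d + r := le_trans (gapA _ _ _ xy zx zy _ Aa) (close _ _ _ _ _ pa pz).
    by exfalso; clear zx zy; lra.
  have CC x y z t p : adj x y -> adj z t -> (enum_rank x < enum_rank y)%N ->
      (enum_rank z < enum_rank t)%N -> p \in C x y -> p \in C z t -> x = z.
    move=> xy zt rxy rzt pC pC'; have [//|xz] := eqVneq x z.
    have [px|px] := boolP (p \in box x); first by rewrite (boxC z t x p).
    have := CU _ _ _ xy pC; have := CU _ _ _ zt pC'.
    rewrite !finset.in_setD => /andP[_]; rewrite inE => /asboolP[b Bb pb].
    move=> /andP[py]; rewrite inE => /asboolP[a Aa pa].
    (* Each edge is assigned to its end of smaller rank only, so two different owners mean two
       different edges. *)
    have ne : [set x; y]%SET != [set z; t]%SET.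
      apply: contra_neq xz => E.
      have : x \in [set z; t]%SET by rewrite -E !inE eqxx.
      have : z \in [set x; y]%SET by rewrite E !inE eqxx.
      rewrite !inE => /orP[/eqP //|/eqP zy] /orP[/eqP //|/eqP xt].
      by move: rxy rzt; rewrite zy xt => h1 h2; have := ltn_trans h1 h2; rewrite ltnn.
    rewrite inE -ltNge in px; rewrite inE -ltNge in py.
    have ax := le_trans _ (away _ _ _ _ _ pa px); have ay := le_trans _ (away _ _ _ _ _ pa py).
    have rd : r / 2%:R <= r - 2%:R * d by clear ne xz; lra.
    have ab := gapE _ _ _ _ xy zt ne a b Aa Bb (ax _ rd) (ay _ rd).
    have h : d3 <= 2%:R * d + 2%:R * d := le_trans ab (close _ _ _ _ _ pa pb).
    by exfalso; clear ne xz; lra.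
  move=> x z p; rewrite !finset.in_setU.
  case/orP=> [px|/bigcupP[y /andP[xy rxy] pC]];
    case/orP=> [pz|/bigcupP[t /andP[zt rzt] pC']].
  + by have [//|xz] := eqVneq x z; have := boxN _ _ _ xz px; rewrite pz.
  + exact: boxC pC' px.
  + by rewrite (boxC _ _ _ _ xy pC pz).
  + exact: (CC _ _ _ _ _ xy zt rxy rzt pC pC').
- move=> x; apply: (@set_connected_from _ _ _ (c x)); first exact: grid_sym.
  move=> p; rewrite inE => /orP[px|/bigcupP[y xy pC]].
    apply: (box_connected (M := N) d0 (a := pos x) (r := r)) => //.
    + by move=> s sx; rewrite !inE sx.
    + by have := cbox x; rewrite inE.
    + by rewrite inE in px.
  have sub s : connect (rel_in (@grid n.+1) (U x y :\: box y)) (c x) s -> s \in B x.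
    by move=> h; rewrite inE; apply/orP; right; apply/bigcupP; exists y; rewrite // inE.
  move: pC; rewrite inE => /connectP[s]; elim/last_ind: s p => [|s q IH] p /=.
    by move=> _ ->; exact: connect0.
  rewrite rcons_path last_rcons => /andP[ps /[dup] e1 /and3P[gq _ _]] ->.
  apply: connect_trans (IH _ ps erefl) _; apply: connect1; apply/and3P; split=> //.
    by apply: sub; apply/connectP; exists s.
  apply: sub; apply/connectP; exists (rcons s q); last by rewrite last_rcons.
  by rewrite rcons_path ps.
- suff H x y : adj x y -> (enum_rank x < enum_rank y)%N ->
      exists p q, [/\ p \in B x, q \in B y & grid p q].
    move=> x y xy; have [lt|lt|E] := ltngtP (enum_rank x) (enum_rank y).
    + exact: H.
    + have [||p [q [pB qB g]]] := H y x => //; first by rewrite adj_sym.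
      by exists q, p; split=> //; rewrite grid_sym.
    + by move: xy; rewrite (enum_rank_inj (ord_inj E)) adj_irrefl.
  move=> xy rxy.
  (* The grid path along the arc from [c x] to [c y] must leave [C x y]. As this is a whole
     component of the thickened arc outside [box y], it can only leave into [box y]. *)
  have [||u [v [uC vC g vU]]] := @connect_first_exit _ _ (U x y) (C x y) (c x) (c y) _ _ (arc_conn _ _ xy).
  + by rewrite inE; exact: connect0.
  + by apply/negP => /(CU _ _ _ xy); rewrite finset.in_setD cbox.
  exists u, v; split=> //.
    by rewrite finset.in_setU; apply/orP; right; apply/bigcupP; exists y; rewrite ?xy.
  rewrite finset.in_setU; apply/orP; left; apply: contraR vC => vy.
  have uU := CU _ _ _ xy uC.
  rewrite inE in uC; rewrite inE; apply: connect_trans uC _; apply: connect1.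
  by rewrite /rel_in g uU finset.in_setD vy.
Qed.

End Topology.

Lemma bigmin_le_mem (T : eqType) (s : seq T) (F : T -> nat) m x :
  x \in s -> (\big[minn/m]_(i <- s) F i <= F x)%N.
Proof.
elim: s => // y s IH; rewrite inE big_cons geq_min => /orP[/eqP ->|/IH ->].
  by rewrite leqnn.
by rewrite orbT.
Qed.

Local Close Scope ring_scope.

Theorem theorem13 (R : realType) (G : plane_graph R)
  (hmin : min_degree G = 5)
  (hmax : 16 <= max_degree G) :
  exists2 H : {set G}, minor_5_star H & weight H <= max_degree G + 28.
Proof.
have adjC := @adj_sym G; have adjI := @adj_irrefl G.
have deg5 (x : G) : 5 <= deg x.
  by rewrite -hmin; apply: bigmin_le_mem; rewrite mem_index_enum.
have degD (x : G) : deg x <= max_degree G.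
  exact: (leq_bigmax (F := fun x : G => deg x)).
(* For an empty graph [min_degree] would be its neutral value 0. *)
have V0 : 0 < #|G|.
  rewrite lt0n; apply/eqP => G0; move: hmin; rewrite /min_degree.
  by rewrite big_pred0 ?G0 // => x; case: (fintype0 x G0).
have [/existsP[c /andP[/eqP dc wc]]|/existsPn heavy] := boolP
    [exists c : G, (deg c == 5) && (weight (c |: neighbors c)%SET <= max_degree G + 28)].
  by exists (c |: neighbors c)%SET => //; exists c.
have [n [B [Bint Bdisj Bconn Badj]]] := plane_grid_minor G.
have [|||||k [f fs]] := @grid_minor_face_system G adj n B adjC adjI V0.
- apply: (@leq_trans (\sum_(x : G) 5)).
    by rewrite sum_nat_const -muln2 ltn_mul2l V0.
  by apply: leq_sum => x _; exact: deg5.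
- by move=> x p /Bint[h1 h2]; apply/andP.
- exact: Bdisj.
- exact: Bconn.
- exact: Badj.
exfalso; apply: (@heavy_stars_absurd G adj k f (max_degree G)) => // c dc.
(* A weight of at least D + 29 minus the 5 of the centre leaves D + 24 for the neighbours. *)
have := heavy c; rewrite [deg c]dc eqxx /= -ltnNge /weight big_setU1 /=; last first.
  by rewrite inE adjI.
rewrite [deg c]dc; under eq_bigl => u do rewrite inE.
rewrite -[X in _ -> _ <= X]/(\sum_(u | adj c u) deg u).
by lia.
Qed.
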